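(* Let $k\geq 3$, $n\geq 2$, $D\geq 1$ be integers satisfying $k>2^{n-1}D$. Let $\Psi$ be any real-valued function on the positive integers with $\Psi(N)\geq 2$ for all $N$. There is a constant $C=C(k,D,\Psi)>0$ such that for all nonempty finite sets $S\subseteq\mathbb{Z}$, writing $N:=|S|$, if $\mathrm{Type}_{k,D}(S)\leq N\,\Psi(N)$, then $$\frac{r_{k,D}(S)}{N} \geq C \exp\left(-n\, 2^{(n-1)/2} D^{(n-1)/n} \sqrt[n]{\log \Psi(N)}+ \frac{1}{2n}\log\log \Psi(N)\right),$$ where $\exp(x)=2^x$ and $\log x=\log_2 x$.
   Context: Conventions: $\exp(x)$ denotes $2^x$ and $\log x$ denotes $\log_2(x)$. A $k$-term $D$-progression is a nonconstant sequence $a_1,\dots,a_k$ for which there is a nonconstant polynomial $Q(j)$ (with real coefficients) of degree at most $D$ with $Q(i)=a_i$ for all $i\in\{1,\dots,k\}$ (equivalently, a nonconstant sequence whose $(D+1)$-st differences are all zero). Terms may repeat; e.g. $4,1,0,1,4$ is a $5$-term $2$-progression. If $Q(j)=\sum_{i=0}^{D'} q_i j^i$ has degree exactly $D'\geq 1$ (so $q_{D'}\neq 0$), the type of the sequence $Q(1),\dots,Q(k)$ is the triple $(D',\,Q(1),\,D'!\,q_{D'})$. Different progressions can have the same type. For a finite set $S$ of integers, $\mathrm{Type}_{k,D}(S)$ is the number of distinct types of $k$-term $D$-progressions all of whose terms lie in $S$. For a finite set $S$ of integers, $r_{k,D}(S)$ is the maximum cardinality of a subset $A\subseteq S$ such that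 $A$ does not contain (all the terms of) any $k$-term $D$-progression. *)

(* Defs.v *)
From HB Require Import structures.
From mathcomp Require Import all_boot all_order all_algebra finmap.
From mathcomp Require Import all_classical all_reals all_analysis.

Set Implicit Arguments.
Unset Strict Implicit.
Unset Printing Implicit Defensive.

Import Order.TTheory GRing.Theory Num.Theory.
Local Open Scope classical_set_scope.
Local Open Scope ring_scope.

Definition exp2 (R : realType) (x : R) : R := 2 `^ x.
Definition log2 (R : realType) (x : R) : R := ln x / ln 2.
Definition nroot (R : realType) (n : nat) (x : R) : R := x `^ (n%:R^-1).

(* A sequence a_1, ..., a_k is encoded as a : 'I_k -> int, the ordinal i
   carrying the term a_(i+1); hence the evaluation points i.+1. *)
Definition generates (R : realType) (k D : nat) (Q : {poly R})
    (a : 'I_k -> int) : Prop :=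
  (1 < size Q <= D.+1)%N /\ forall i : 'I_k, Q.[i.+1%:R] = (a i)%:~R.

Definition nonconstant (k : nat) (a : 'I_k -> int) : Prop :=
  exists i j : 'I_k, a i <> a j.

Definition progression (R : realType) (k D : nat) (a : 'I_k -> int) : Prop :=
  nonconstant a /\ exists Q : {poly R}, generates D Q a.

Definition terms_in (k : nat) (a : 'I_k -> int) (A : {fset int}) : Prop :=
  forall i : 'I_k, a i \in A.

(* (D', Q(1), D'! q_D') where D' = (size Q).-1 is the exact degree of Q. *)
Definition type_of (R : realType) (Q : {poly R}) : nat * R * R :=
  ((size Q).-1, Q.[1], ((size Q).-1)`!%:R * lead_coef Q).

Definition types (R : realType) (k D : nat) (S : {fset int}) :
    set (nat * R * R) :=
  [set t | exists (a : 'I_k -> int) (Q : {poly R}),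
     [/\ nonconstant a, generates D Q a, terms_in a S & t = type_of Q]].

Lemma generates_inj (R : realType) (k D : nat) (P Q : {poly R})
    (a : 'I_k -> int) :
  (D < k)%N -> generates D P a -> generates D Q a -> P = Q.
Proof.
move=> ltDk [/andP[_ sP] eP] [/andP[_ sQ] eQ].
apply/eqP; rewrite -subr_eq0; apply/eqP.
apply: (@roots_geq_poly_eq0 _ _ [seq (i.+1)%:R | i : 'I_k]).
- apply/allP => _ /mapP[i _ ->].
  by rewrite rootE hornerD hornerN eP eQ subrr.
- rewrite map_inj_uniq ?enum_uniq// => i j /eqP.
  by rewrite eqr_nat eqSS => /eqP /val_inj.
- rewrite size_map size_enum_ord; apply: leq_trans ltDk.
  by apply: leq_trans (size_polyD _ _) _; rewrite size_polyN geq_max sP.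
Qed.

(* So the cardinal below is the true number of types as soon as D < k
   (fset_set sends infinite sets to fset0). *)
Lemma finite_types (R : realType) (k D : nat) (S : {fset int}) :
  (D < k)%N -> finite_set (@types R k D S).
Proof.
move=> ltDk.
pose seq_of (b : {ffun 'I_k -> S}) (i : 'I_k) : int := fsval (b i).
pose g b := type_of (xget 0 [set Q : {poly R} | generates D Q (seq_of b)]).
apply: (sub_finite_set _ (finite_image g (@finite_finset _ setT))).
move=> _ [a [Q [_ Qa aS ->]]].
exists [ffun i => [` aS i]%fset] => //; rewrite /g; congr type_of.
have Qb : generates D Q (seq_of [ffun i => [` aS i]%fset]).
  by split=> [|i]; [case: Qa | rewrite /seq_of ffunE /=; case: Qa].
have Pb := xgetPex 0 (ex_intro (generates D ^~ _) Q Qb).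
exact: generates_inj ltDk Pb Qb.
Qed.

Definition TypekD (R : realType) (k D : nat) (S : {fset int}) : nat :=
  #|` fset_set (@types R k D S)|%fset.

Definition progression_free (R : realType) (k D : nat) (A : {fset int}) : Prop :=
  ~ exists a : 'I_k -> int, progression R D a /\ terms_in a A.

Definition rkD (R : realType) (k D : nat) (S : {fset int}) : nat :=
  (\max_(A <- fpowerset S | `[< progression_free R k D A >]) #|` A|%fset)%N.

(* Main.v *)
Require Import Defs.
From mathcomp Require Import all_boot all_order all_algebra finmap zify ring lra.
From mathcomp Require Import all_classical all_reals all_analysis.
Import Order.TTheory GRing.Theory Num.Theory.
Local Open Scope ring_scope.

(** The construction is the Behrend-Rankin-Elkin one, made relative to [S].
    Send each [s] in [S] to the point [s om + al] of [(Z/M)^d], where [M] is a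
    large modulus and [om], [al] are random. Keep [s] when this point lies in a
    box [[0, w)^d] of side about [M / 2^D] and its squared length, a sum of
    squares of representatives, lies in a union of thin shells
    [c + a Dl + [0, dl)], with [a] in an index set [A] that contains no
    progression of degree at most [2 D].

    Let a progression of degree [s] and leading difference [e] have all its
    terms kept. The box is so narrow that the representatives inherit vanishing
    differences of order [s + 1] ([fdiffn_dvd_eq0]): they form a polynomial
    curve in Z^d, whose squared length is a polynomial of degree [2 s]. So the
    shell indices along the curve form a progression of degree at most [2 D] or
    a constant; by the choice of [A] they are constant, the curve stays in one
    thin shell, and its leading coefficient, a representative of [e om], is
    short ([shells_rigidity]). For each type this event is rare, because a
    d-dimensional ball has tiny volume ([card_lattice_ball]), and it is
    independent of the position of the first term ([random_affine_map]). As
    there are few types, deleting the first term of every bad type costs at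
    most half of the kept points. The squared length of a point of the box is
    concentrated ([box_concentration]), so an average over the translation [c]
    of the shells replaces every exact volume computation ([popular_shells]).
    The outcome is the inequality [rkD_ge_shells], for all [d], [A] and [S].

    It remains to choose [d] and [A]. For [n = 2] one shell is taken. For
    [n > 2] the set [A] is the dense subset of an initial segment that the
    theorem itself gives for [n - 1] and [2 D] ([shells_of_density]); an initial
    segment of length [L] has only [O(L^2)] types, and [L] is about
    [2^(2 Lg / d)] with [Lg = log2 psi]. The total cost in the exponent,
    [D d] for the box plus the cost of [A], is smallest at a real dimension
    [opt_dim] where it equals the claimed main term, and rounding that
    dimension up loses a bounded factor ([exponent_bound]). The double
    logarithm comes, for [n = 2], from the proportion of the box in one shell:
    the affordable width of a shell is proportional to [d], whereas the squared
    lengths spread over [sqrt d] only, which gains a factor [sqrt d]; the gain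
    survives each induction step. *)

Set Implicit Arguments.
Unset Strict Implicit.
Unset Printing Implicit Defensive.

(** * Finite differences *)

Definition fdiff (V : zmodType) (f : nat -> V) (j : nat) : V := f j.+1 - f j.
Definition fdiffn (V : zmodType) (s : nat) (f : nat -> V) : nat -> V :=
  iter s (@fdiff V) f.

Lemma fdiffnS (V : zmodType) s (f : nat -> V) j :
  fdiffn s.+1 f j = fdiffn s f j.+1 - fdiffn s f j.
Proof. by []. Qed.

Lemma eq_fdiffn (V : zmodType) s (f g : nat -> V) i :
  (forall j, (i <= j <= i + s)%N -> f j = g j) -> fdiffn s f i = fdiffn s g i.
Proof.
elim: s i => [|s IHs] i fg; first by apply: fg; rewrite leqnn leq_addr.
by rewrite !fdiffnS !IHs // => j /andP[ij js]; apply: fg; lia.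
Qed.

Lemma fdiffnSr (V : zmodType) s (f : nat -> V) j :
  fdiffn s.+1 f j = fdiffn s (fdiff f) j.
Proof. by rewrite /fdiffn iterSr. Qed.

Lemma fdiffn_sum (V : zmodType) (I : finType) s (f : I -> nat -> V) j :
  fdiffn s (fun l => \sum_i f i l) j = \sum_i fdiffn s (f i) j.
Proof.
elim: s j => [//|s IHs] j; rewrite fdiffnS !IHs -sumrB.
exact: eq_bigr.
Qed.

Lemma fdiffnD (V : zmodType) s (f g : nat -> V) j :
  fdiffn s (fun l => f l + g l) j = fdiffn s f j + fdiffn s g j.
Proof. by elim: s j => [//|s IHs] j; rewrite !fdiffnS !IHs opprD addrACA. Qed.

Lemma fdiffnMn (V : zmodType) s (f : nat -> V) n j :
  fdiffn s (fun l => f l *+ n) j = fdiffn s f j *+ n.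
Proof. by elim: s j => [//|s IHs] j; rewrite !fdiffnS !IHs mulrnBl. Qed.

Lemma fdiffn_const (V : zmodType) s (c : V) j :
  fdiffn s.+1 (fun=> c) j = 0.
Proof.
elim: s j => [|s IHs] j; first exact: subrr.
by rewrite fdiffnS !IHs subrr.
Qed.

Lemma raddf_fdiffn (U V : zmodType) (h : {additive U -> V}) s (f : nat -> U) j :
  h (fdiffn s f j) = fdiffn s (h \o f) j.
Proof. by elim: s j => [//|s IHs] j; rewrite !fdiffnS raddfB !IHs. Qed.

Lemma fdiffn_vanish (V : zmodType) (k s t : nat) (f : nat -> V) :
  (forall j, (j + s < k)%N -> fdiffn s f j = 0) ->
  (s <= t)%N -> forall j, (j + t < k)%N -> fdiffn t f j = 0.
Proof.
move=> f0 /subnK <-; elim: (t - s)%N => [//|u IHu] j jk.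
rewrite addSn fdiffnS !IHu ?subrr //; lia.
Qed.

Lemma fdiffn_bound (R : realDomainType) s (f : nat -> R) (W : R) i :
  (forall j, (i <= j <= i + s.+1)%N -> 0 <= f j <= W) ->
  `|fdiffn s.+1 f i| <= 2 ^+ s * W.
Proof.
elim: s i => [|s IHs] i fW.
  have /andP[? ?] := fW i ltac:(lia); have /andP[? ?] := fW i.+1 ltac:(lia).
  by rewrite expr0 mul1r /fdiffn /= /fdiff ler_norml; apply/andP; split; lra.
rewrite fdiffnS exprS -mulrA mulr_natl mulr2n.
by apply: (le_trans (ler_normB _ _)); apply: lerD; apply: IHs => j ?; apply: fW; lia.
Qed.

(** A multiple of [M] smaller than [M] is zero. Since differences commute with
    reduction modulo [M], this is how a sequence confined to a window narrow
    compared with [M] inherits vanishing differences from a sequence congruent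
    to it. *)
Lemma fdiffn_dvd_eq0 (M : nat) s (f : nat -> int) (W : int) i :
  (forall j, (i <= j <= i + s.+1)%N -> 0 <= f j <= W) -> 2 ^+ s * W < M%:Z ->
  (M %| fdiffn s.+1 f i)%Z -> fdiffn s.+1 f i = 0.
Proof.
move=> /fdiffn_bound fW WM /dvdzP[q eq]; move: fW; rewrite eq => fW.
have := le_lt_trans fW WM; case: (eqVneq q 0) => [->|q0]; first by rewrite mul0r.
by rewrite normrM => h; nia.
Qed.

(** Newton's forward formula: [(1 + Delta)^j] applied at [l]. *)
Lemma newton_forward (V : zmodType) (a : nat -> V) (j l : nat) :
  a (l + j)%N = \sum_(i < j.+1) fdiffn i a l *+ 'C(j, i).
Proof.
elim: j a l => [|j IHj] a l; first by rewrite big_ord1 addn0 bin0 mulr1n.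
have -> : a (l + j.+1)%N = fdiff a (l + j) + a (l + j)%N.
  by rewrite /fdiff subrK addnS.
rewrite !IHj [RHS]big_ord_recl /= bin0 mulr1n.
under [X in _ = _ + X]eq_bigr => i _ do rewrite /bump /= add1n binS mulrnDr.
rewrite big_split /= [X in _ = _ + (X + _)]big_ord_recr /= bin_small // mulr0n addr0.
rewrite [X in _ + X = _]big_ord_recl /= bin0 mulr1n addrCA; congr (_ + _).
rewrite addrC; congr (_ + _); apply: eq_bigr => i _.
by rewrite -fdiffnSr.
Qed.

Section Interpolation.
Variable F : numFieldType.
Implicit Types (P Q : {poly F}) (a : nat -> F).

Definition newton_poly (s : nat) a : {poly F} :=
  \sum_(i < s) (fdiffn i a 0 / (i`!)%:R) *: \prod_(l < i) ('X - (l%:R)%:P).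

Lemma size_newton_poly s a : (size (newton_poly s a) <= s)%N.
Proof.
apply: (leq_trans (size_sum _ _ _)); apply/bigmax_leqP => i _.
by rewrite (leq_trans (size_scale_leq _ _)) // size_prod_XsubC /= [index_enum _]unlock -enumT size_enum_ord.
Qed.

Lemma prod_falling (j i : nat) :
  \prod_(l < i) (j%:R - l%:R : F) = (j ^_ i)%:R.
Proof.
elim: i => [|i IHi]; first by rewrite big_ord0 ffactn0.
rewrite big_ord_recr /= IHi ffactnSr natrM.
have [ij|ji] := leqP i j; first by rewrite natrB.
by rewrite ffact_small // !mul0r.
Qed.

(** The differences of order at least [s] that Newton's formula uses at [j < k]
    involve only terms of the window, so they vanish. *)
Lemma horner_newton_poly (k s : nat) a :
  (forall j, (j + s < k)%N -> fdiffn s a j = 0) ->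
  forall j, (j < k)%N -> (newton_poly s a).[j%:R] = a j.
Proof.
move=> a0 j jk; rewrite /newton_poly horner_sum.
under eq_bigr => i _.
  rewrite hornerZ horner_prod; under eq_bigr => l _ do rewrite hornerXsubC.
  rewrite prod_falling -bin_ffact natrM -mulrA (mulrC _^-1) mulfK; last first.
    by rewrite pnatr_eq0 -lt0n fact_gt0.
  rewrite mulr_natr.
  over.
rewrite -[RHS]/(a (0 + j)%N) newton_forward.
rewrite -(big_mkord xpredT (fun i => fdiffn i a 0 *+ 'C(j, i))).
rewrite -[RHS](big_mkord xpredT (fun i => fdiffn i a 0 *+ 'C(j, i))).
have [sj|js] := leqP s j.+1.
  rewrite [RHS](big_cat_nat (leq0n s) sj) /= [X in _ = _ + X]big_nat_cond.
  rewrite [X in _ = _ + X]big1 ?addr0 // => i /andP[/andP[si ij] _].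
  by rewrite (fdiffn_vanish a0 si) ?mul0rn //; lia.
rewrite (big_cat_nat (leq0n j.+1) (ltnW js)) /= [X in _ + X = _]big_nat_cond.
rewrite [X in _ + X = _]big1 ?addr0 // => i /andP[/andP[si ij] _].
by rewrite bin_small ?mulr0n.
Qed.

Lemma coef_shift P s :
  (P \Po ('X + 1))`_s = \sum_(i < size P) P`_i *+ 'C(i, s).
Proof.
rewrite comp_polyE coef_sum; apply: eq_bigr => i _.
rewrite coefZ exprDn coef_sum.
under eq_bigr => j _ do rewrite expr1n mulr1 coefMn coefXn.
have [si|is_] := leqP s i.
  rewrite (bigD1 (Ordinal (leq_ltn_trans (leq_subr s i) (ltnSn i)))) //= subKn //.
  rewrite eqxx big1 => [|j jn].
    by rewrite addr0 bin_sub // mulr_natr.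
  case: eqP => [e|_]; last by rewrite mul0rn.
  by case/eqP: jn; apply: val_inj => /=; have := ltn_ord j; lia.
rewrite bin_small // mulr0n big1 ?mulr0 // => j _.
by case: eqP => [e|_]; [have := ltn_ord j; lia | rewrite mul0rn].
Qed.

(** The difference operator lowers the degree and multiplies the leading
    coefficient by the degree, as differentiation does. *)
Lemma fdiffn_horner P s (x : F) j : (size P <= s.+1)%N ->
  fdiffn s (fun l => P.[x + l%:R]) j = s`!%:R * P`_s.
Proof.
elim: s P j => [|s IHs] P j sP.
  by rewrite [P]size1_polyC // /fdiffn /= hornerC coefC mul1r.
pose Q := P \Po ('X + 1) - P.
have QE l : fdiff (fun l => P.[x + l%:R]) l = Q.[x + l%:R].
  by rewrite /fdiff /Q hornerD hornerN horner_comp !hornerE -addrA -natr1 addrA.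
have Qs t : (s < t)%N -> Q`_t = 0.
  move=> st; rewrite /Q coefB coef_shift; have [tP|Pt] := ltnP t (size P).
    rewrite (bigD1 (Ordinal tP)) //= binn mulr1n big1 ?addr0 ?subrr // => i it.
    rewrite bin_small ?mulr0n //.
    have /eqP : (i : nat) != t by [].
    by move: (size P) (nat_of_ord i) sP (ltn_ord i) st tP {it} => a b; lia.
  rewrite nth_default // subr0 big1 // => i _.
  by rewrite bin_small ?mulr0n //; apply: leq_trans Pt.
rewrite fdiffnSr (@eq_fdiffn _ _ _ (fun l => Q.[x + l%:R])) => [|l _]; last exact: QE.
rewrite IHs; last by apply/leq_sizeP => t st; apply: Qs.
rewrite factS natrM [_.+1%:R * _]mulrC -mulrA; congr (_ * _).
rewrite /Q coefB coef_shift.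
rewrite (_ : \sum_(i < _) _ = P`_s + P`_s.+1 *+ s.+1); first by rewrite addrAC subrr add0r mulr_natl.
rewrite -(big_mkord xpredT (fun i => P`_i *+ 'C(i, s))).
have -> : \sum_(0 <= i < size P) P`_i *+ 'C(i, s) = \sum_(0 <= i < s.+2) P`_i *+ 'C(i, s).
  rewrite [RHS](big_cat_nat (leq0n (size P)) sP) /= [X in _ = _ + X]big_nat_cond.
  by rewrite [X in _ = _ + X]big1 ?addr0 // => i /andP[/andP[Pi _] _]; rewrite nth_default ?mul0rn.
rewrite !big_nat_recr //= big_nat_cond big1 ?add0r => [|i /andP[/andP[_ ?] _]].
  by rewrite binn binSn mulr1n.
by rewrite bin_small ?mulr0n.
Qed.

Lemma fdiffn_horner0 P s (x : F) j : (size P <= s)%N ->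
  fdiffn s (fun l => P.[x + l%:R]) j = 0.
Proof. by move=> sP; rewrite fdiffn_horner ?nth_default ?mulr0 //; apply: leqW. Qed.

End Interpolation.

Lemma interpolate (F : numFieldType) (k s : nat) (x : nat -> int) :
  (forall j, (j + s < k)%N -> fdiffn s x j = 0) ->
  exists2 P : {poly F}, (size P <= s)%N &
    forall j, (j < k)%N -> P.[j%:R] = (x j)%:~R.
Proof.
move=> x0; exists (newton_poly s (fun j => (x j)%:~R : F)).
  exact: size_newton_poly.
apply: horner_newton_poly => j jk.
by rewrite -(raddf_fdiffn (intmul (1 : F))) x0 // mulr0z.
Qed.

Lemma intr_fdiffn_horner (F : numFieldType) (k t : nat) (x : nat -> int)
    (P : {poly F}) j :
  (forall l, (l < k)%N -> P.[l%:R] = (x l)%:~R) -> (j + t < k)%N ->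
  (fdiffn t x j)%:~R = fdiffn t (fun l => P.[0 + l%:R]) j.
Proof.
move=> Px jk; rewrite (raddf_fdiffn (intmul (1 : F))).
by apply: eq_fdiffn => l /andP[_ lt]; rewrite add0r Px //=; lia.
Qed.

(** * Rigidity of polynomial curves in shells *)

Section Square.
Variables (k s : nat) (x : nat -> int).
Hypothesis x0 : forall j, (j + s.+1 < k)%N -> fdiffn s.+1 x j = 0.

Lemma fdiffn_sqr_eq0 j : (j + s.*2.+1 < k)%N ->
  fdiffn s.*2.+1 (fun l => x l ^+ 2) j = 0.
Proof.
move=> jk; have [P sP Px] := interpolate rat x0.
apply/eqP; rewrite -(intr_eq0 rat); apply/eqP.
rewrite (@intr_fdiffn_horner _ k _ _ (P ^+ 2)) // => [|l lk].
  by apply: fdiffn_horner0; rewrite (leq_trans (size_poly_exp_leq _ _)) //; move: (size _) sP => a; lia.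
by rewrite hornerE Px // rmorphXn.
Qed.

(** Squaring doubles the degree and squares the leading coefficient, and
    [(2 s)! >= (s!)^2]. *)
Lemma fdiffn_sqr_ge j : (j + s.*2 < k)%N ->
  fdiffn s x j ^+ 2 <= fdiffn s.*2 (fun l => x l ^+ 2) j.
Proof.
move=> jk; have [P sP Px] := interpolate rat x0.
have sP2 : (size (P ^+ 2)%R <= s.*2.+1)%N.
  by rewrite (leq_trans (size_poly_exp_leq _ _)) //; move: (size _) sP => a; lia.
have P2 : (P ^+ 2)`_(s.*2) = P`_s ^+ 2.
  have ls : (s < s.*2.+1)%N by lia.
  rewrite expr2 coefM (bigD1 (Ordinal ls)) //= big1 ?addr0 => [|i is_].
    by rewrite -addnn addnK.
  have /eqP is' : (i : nat) != s by [].
  have [si|lis] := ltnP s i; first by rewrite [P`_i]nth_default ?mul0r // (leq_trans sP).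
  rewrite [P`_(_ - _)]nth_default ?mulr0 // (leq_trans sP) //; move: (ltn_ord i); lia.
rewrite -(ler_int rat) rmorphXn /= (@intr_fdiffn_horner _ k _ _ P) //; last by lia.
rewrite (@intr_fdiffn_horner _ k _ _ (P ^+ 2)) // => [|l lk]; last first.
  by rewrite hornerE Px // rmorphXn.
rewrite !fdiffn_horner // P2 exprMn ler_wpM2r ?sqr_ge0 // -natrX ler_nat.
have := @bin_fact s.*2 s ltac:(lia); rewrite -addnn addnK => <-.
by rewrite leq_pmull ?bin_gt0 ?leq_addr.
Qed.

End Square.

(** If the squared lengths of a polynomial curve of degree [s] lie close to
    [c + a_j D] then the integers [a_j] have vanishing differences of order
    [2 s + 1] too; if that forces them to be constant, then all squared lengths
    lie in one thin shell, and this makes the leading coefficient small. *)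
Lemma shells_rigidity (I : finType) (k s : nat) (x : I -> nat -> int)
    (a : nat -> nat) (e : nat -> nat) (c : int) (d D : nat) :
  (0 < s)%N -> (s.*2 < k)%N ->
  (forall i j, (j + s.+1 < k)%N -> fdiffn s.+1 (x i) j = 0) ->
  (forall j, (j < k)%N -> \sum_i x i j ^+ 2 = c + (a j * D + e j)%N%:Z) ->
  (forall j, (j < k)%N -> (e j < d)%N) -> (2 ^ s.*2 * d <= D)%N ->
  ((forall j, (j + s.*2.+1 < k)%N -> fdiffn s.*2.+1 (fun l => (a l)%:Z) j = 0) ->
     forall j, (j < k)%N -> a j = a 0%N) ->
  \sum_i fdiffn s (x i) 0 ^+ 2 <= (2 ^ s.*2 * d)%N%:Z.
Proof.
move=> s0 sk xP xE ed dD aP.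
have d0 : (0 < d)%N by apply: leq_ltn_trans (ed 0%N _) => //; lia.
have sE t j : (j + t.+1 < k)%N ->
    \sum_i fdiffn t.+1 (fun l => x i l ^+ 2) j =
      fdiffn t.+1 (fun l => (a l)%:Z) j *+ D + fdiffn t.+1 (fun l => (e l)%:Z) j.
  move=> jk; rewrite -fdiffn_sum.
  transitivity (fdiffn t.+1 (fun l => c + ((a l)%:Z *+ D + (e l)%:Z)) j).
    apply: eq_fdiffn => l /andP[_ lk]; rewrite xE; last by lia.
    by rewrite PoszD PoszM -mulr_natr natz.
  rewrite !fdiffnD fdiffn_const add0r.
  by rewrite fdiffnMn.
have eB t j : (j + t.+1 < k)%N ->
    `|fdiffn t.+1 (fun l => (e l)%:Z) j| <= 2 ^+ t * (d.-1)%:Z.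
  by move=> jk; apply: fdiffn_bound => l /andP[_ lk]; have := ed l ltac:(lia); lia.
have a0 j : (j + s.*2.+1 < k)%N -> fdiffn s.*2.+1 (fun l => (a l)%:Z) j = 0.
  move=> jk; have := sE _ _ jk; rewrite big1 => [|i _]; last first.
    exact: fdiffn_sqr_eq0 (xP i) _ jk.
  have := eB _ _ jk; set u := fdiffn _ _ j; set v := fdiffn _ _ j.
  rewrite -natrX natz => ub /eqP; rewrite eq_sym addr_eq0 => /eqP uv.
  have : `|v *+ D| < D%:Z.
    by rewrite uv normrN (le_lt_trans ub) //; nia.
  rewrite -mulr_natr natz; clear; case: (eqVneq v 0) => // v0; nia.
have {}aP := aP a0.
case: s s0 sk {xP} (fun i j => @fdiffn_sqr_ge k s (x i) (xP i) j) {dD a0} sE eB => // s _ sk xP sE eB.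
apply: le_trans (ler_sum _ (fun i _ => xP i 0%N _)) _ => //.
rewrite doubleS (sE s.*2.+1 0%N) //.
rewrite (@eq_fdiffn _ _ _ (fun=> (a 0%N)%:Z)) => [|l /andP[_ lk]]; last by rewrite aP //; lia.
rewrite fdiffn_const mul0rn add0r (le_trans (ler_norm _)) //.
rewrite (le_trans (eB s.*2.+1 0%N _)) //.
rewrite -natrX natz !expnS -PoszM lez_nat; nia.
Qed.

(** * Random affine maps and counting *)

Lemma exists_le_of_sum (T : finType) (f g : T -> nat) : (0 < #|T|)%N ->
  (\sum_t f t <= \sum_t g t)%N -> exists t, (f t <= g t)%N.
Proof.
move=> T0; apply: contraPP => /forallNP fg; apply/negP; rewrite -ltnNge.
have {}fg t : (g t < f t)%N by have /negP := fg t; rewrite -ltnNge.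
have [t _] := card_gt0P T0.
rewrite (bigD1 t) //= [X in (_ < X)%N](bigD1 t) //= -addSn leq_add //.
by apply: leq_sum => u _; apply: ltnW.
Qed.

Section RandomAffineMap.
Variables (G : finZmodType) (T : {set G}).

Lemma card_translate_preim (x : G) : #|[set al | x + al \in T]| = #|T|.
Proof.
rewrite -(card_imset T (@addrI _ (- x))); congr #|pred_of_set _|.
apply/setP => al; rewrite inE; apply/idP/imsetP => [xT|[y yT ->]].
  by exists (x + al); rewrite // addKr.
by rewrite addrA subrr add0r.
Qed.

(** Choose [w] and [al] uniformly in [G]. For each integer [s] the point
    [w s + al] is uniform and independent of [w], so that averages over the
    pair factor. *)
Lemma random_affine_map (S : seq int) (P : seq (int * int))
    (bad : G -> int -> bool) (B : nat) :
  (forall p, p \in P -> (#|[set w | bad w p.2]| <= B)%N) ->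
  exists w al : G,
    (size S * #|T| * #|G|
       + count (fun p => ((w *~ p.1 + al)%R \in T) && bad w p.2) P * #|G| ^ 2
     <= count (fun s => (w *~ s + al)%R \in T) S * #|G| ^ 2 + size P * B * #|T|)%N.
Proof.
move=> badB.
pose cS (z : G * G) := count (fun s => z.1 *~ s + z.2 \in T) S.
pose cP (z : G * G) := count (fun p => (z.1 *~ p.1 + z.2 \in T) && bad z.1 p.2) P.
have sumS : (\sum_z cS z = size S * #|T| * #|G|)%N.
  under eq_bigr => z _ do rewrite /cS -sum1_count big_mkcond.
  rewrite exchange_big /= -mulnA -[in RHS](card_ord (size S)) -sum_nat_const.
  rewrite big_tnth; apply: eq_bigr => i _.
  rewrite -(pair_bigA _ (fun w al => if (w *~ tnth (in_tuple S) i + al)%R \in T then 1 else 0)%N) /=.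
  rewrite mulnC -sum_nat_const.
  apply: eq_bigr => w _.
  rewrite -(card_translate_preim (w *~ tnth (in_tuple S) i)) -sum1_card [RHS]big_mkcond.
  by apply: eq_bigr => al _; rewrite inE.
have sumP : (\sum_z cP z <= size P * B * #|T|)%N.
  under eq_bigr => z _ do rewrite /cP -sum1_count big_mkcond.
  rewrite exchange_big /= -mulnA -[in X in (_ <= X)%N](card_ord (size P)).
  rewrite -sum_nat_const big_tnth; apply: leq_sum => i _.
  set p := tnth _ _.
  rewrite -(pair_bigA _ (fun w al => if ((w *~ p.1 + al)%R \in T) && bad w p.2 then 1 else 0)%N) /=.
  apply: (@leq_trans (\sum_(w in [set w | bad w p.2]) #|T|)).
    rewrite [X in (_ <= X)%N]big_mkcond; apply: leq_sum => w _; rewrite inE.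
    case: (bad w p.2) => /=; last by rewrite big1 // => al _; rewrite andbF.
    rewrite -(card_translate_preim (w *~ p.1)) -sum1_card [X in (_ <= X)%N]big_mkcond.
    by apply: leq_sum => al _; rewrite inE andbT.
  by rewrite sum_nat_const leq_mul2r badB ?orbT // mem_tnth.
have G0 : (0 < #|{: G * G}|)%N by apply/card_gt0P; exists (0, 0).
have [|[w al] h] := @exists_le_of_sum _
    (fun z => size S * #|T| * #|G| + cP z * #|G| ^ 2)%N
    (fun z => cS z * #|G| ^ 2 + size P * B * #|T|)%N G0; last by exists w, al.
rewrite !big_split /= !sum_nat_const -!big_distrl /= sumS card_prod.
have := leq_mul sumP (leqnn (#|G| * #|G|)).
move: (size P * B * #|T|)%N (\sum_z cP z)%N #|G| => u c g.
by rewrite !(mulnC (g * g)%N) expnS expn1 leq_add2l.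
Qed.
End RandomAffineMap.

Section LatticeBall.
Variable R : realType.

(** Telescoping: for [v > 0], the bound [(m + v)^2 <= 2 (m^2 + v^2)] compares the
    term at [v] with [2 m^2 (1 / (m + v - 1) - 1 / (m + v))]. *)
Lemma sum_lorentz (m n : nat) : (0 < m)%N ->
  \sum_(u < n) (1 + u%:R ^+ 2 / m%:R ^+ 2)^-1 <= 3 * m%:R :> R.
Proof.
move=> m0; have mR : 1 <= m%:R :> R by rewrite ler1n.
have step v : \sum_(u < v.+1) (1 + u%:R ^+ 2 / m%:R ^+ 2)^-1
    <= 1 + 2 * m%:R - 2 * m%:R ^+ 2 / (m%:R + v%:R) :> R.
  elim: v => [|v IHv].
    rewrite big_ord1 expr0n mul0r addr0 invr1 addr0.
    by rewrite expr2 mulrA mulfK ?addrK // gt_eqF //; lra.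
  rewrite big_ord_recr /=; apply: (le_trans (lerD IHv (lexx _))).
  have n0 : 0 <= v%:R :> R by [].
  rewrite -(natr1 v); set x := m%:R in mR *; set y := v%:R in n0 *.
  have -> : (1 + (y + 1) ^+ 2 / x ^+ 2)^-1 = x ^+ 2 / (x ^+ 2 + (y + 1) ^+ 2).
    field; apply/andP; split; [nra | lra].
  rewrite -lerBrDl.
  have -> : 1 + 2 * x - 2 * x ^+ 2 / (x + (y + 1)) - (1 + 2 * x - 2 * x ^+ 2 / (x + y))
     = 2 * x ^+ 2 / ((x + y) * (x + (y + 1))).
    by field; apply/andP; split; lra.
  have xy : 0 < (x + y) * (x + (y + 1)) by nra.
  have xy2 : 0 < x ^+ 2 + (y + 1) ^+ 2 by nra.
  rewrite ler_pdivlMr // mulrAC ler_pdivrMr // -subr_ge0.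
  rewrite (_ : _ - _ = x ^+ 2 * ((x - (y + 1)) ^+ 2 + x + (y + 1))); last by ring.
  by rewrite mulr_ge0 ?sqr_ge0 // !addr_ge0 ?sqr_ge0 //; lra.
have [->|n0] := posnP n; first by rewrite big_ord0 mulr_ge0.
rewrite -(prednK n0); apply: (le_trans (step _)).
by have : 0 <= 2 * m%:R ^+ 2 / (m%:R + n.-1%:R) :> R; [ | lra].
Qed.

(** Markov's inequality for a product weight: where the sum of squares is at
    most [m^2 d] the weight [prod (1 + u_i^2/m^2)^-1] is at least [exp (- d)],
    whereas its total mass is [O(m)^d]. Bounding the ball by the cube around it
    would lose a factor [d^(d/2)], and with it the double logarithm. *)
Lemma card_lattice_ball (d m r Q : nat) : (0 < m)%N -> (Q <= m ^ 2 * d)%N ->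
  #|[set y : {ffun 'I_d -> 'I_r * bool} | (\sum_i (y i).1 ^ 2 <= Q)%N]|%:R
    <= (expR 1 * (6 * m%:R)) ^+ d :> R.
Proof.
move=> m0 Qm; have mR : 0 < m%:R :> R by rewrite ltr0n.
pose wt (u : 'I_r * bool) : R := (1 + u.1%:R ^+ 2 / m%:R ^+ 2)^-1.
have wt0 u : 0 < wt u by rewrite invr_gt0 ltr_pwDl // divr_ge0 ?sqr_ge0.
have sum_wt : \sum_u wt u <= 6 * m%:R.
  rewrite -(pair_bigA _ (fun (u : 'I_r) (b : bool) => (1 + u%:R ^+ 2 / m%:R ^+ 2)^-1)) /=.
  under eq_bigr => u _ do rewrite big_bool /= -mulr2n.
  by rewrite sumrMnl; have := sum_lorentz r m0; rewrite mulr2n; lra.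
rewrite exprMn -sum1_card natr_sum.
apply: (@le_trans _ _ (\sum_(y : {ffun 'I_d -> 'I_r * bool}) expR 1 ^+ d * \prod_i wt (y i))).
  rewrite big_mkcond; apply: ler_sum => y _; case: ifP; last first.
    by move=> _; rewrite mulr_ge0 ?exprn_ge0 ?expR_ge0 // prodr_ge0 // => i _; apply: ltW.
  rewrite inE => yQ; rewrite prodfV ler_pdivlMr ?mul1r; last first.
    by apply: prodr_gt0 => i _; rewrite -invr_gt0.
  apply: (@le_trans _ _ (\prod_i expR ((y i).1%:R ^+ 2 / m%:R ^+ 2))).
    apply: ler_prod => i _; rewrite expR_ge1Dx andbT -invr_ge0; exact: ltW.
  rewrite -expR_sum -expRM_natl ler_expR mulr1 -mulr_suml ler_pdivrMr ?exprn_gt0 //.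
  under eq_bigr => i _ do rewrite -natrX.
  by rewrite -natr_sum -natrX -natrM ler_nat mulnC (leq_trans yQ).
rewrite -mulr_sumr ler_wpM2l ?exprn_ge0 ?expR_ge0 //.
rewrite -(bigA_distr_bigA (fun (i : 'I_d) u => wt u)) prodr_const card_ord.
by rewrite lerXn2r ?nnegrE ?mulr_ge0 ?sumr_ge0 // => u _; apply: ltW.
Qed.

End LatticeBall.

(** * Concentration of squared lengths *)

Section SumOfSquares.
Variable R : realType.

(** The cross terms vanish since distinct coordinates are independent and [g]
    has mean zero. *)
Lemma second_moment (I J : finType) (g : J -> R) (b : R) :
  \sum_j g j = 0 -> (forall j, `|g j| <= b) ->
  \sum_(x : {ffun I -> J}) (\sum_i g (x i)) ^+ 2 <= #|I|%:R * b ^+ 2 * (#|J| ^ #|I|)%:R.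
Proof.
move=> g0 gb.
under eq_bigr => x _ do rewrite expr2 big_distrlr /=.
rewrite exchange_big /= -[in X in _ <= X]mulrA mulr_natl -sumr_const.
apply: ler_sum => i _; rewrite exchange_big (bigD1 i) //=.
rewrite [X in _ + X]big1 ?addr0 => [|l li].
  rewrite -card_ffun -sum1_card natr_sum mulr_sumr; apply: ler_sum => x _.
  by rewrite mulr1 -expr2 -real_normK ?num_real // lerXn2r ?nnegrE // (le_trans _ (gb (x i))).
pose h t : J -> R := if (t == i) || (t == l) then g else fun=> 1.
transitivity (\sum_(x : {ffun I -> J}) \prod_t h t (x t)).
  apply: eq_bigr => x _; rewrite (bigD1 i) //= (bigD1 l) //= big1 ?mulr1 => [|t /andP[ti tl]].
    by rewrite /h !eqxx orbT.
  by rewrite /h (negPf ti) (negPf tl).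
by rewrite -(bigA_distr_bigA h) (bigD1 i) //= /h eqxx g0 mul0r.
Qed.

Lemma concentration (I J : finType) (g : J -> R) (b sigma : R) :
  \sum_j g j = 0 -> (forall j, `|g j| <= b) ->
  0 < sigma -> 2 * #|I|%:R * b ^+ 2 <= sigma ^+ 2 ->
  (#|J| ^ #|I| <= 2 * #|[set x : {ffun I -> J} | (`|\sum_i g (x i)| < sigma)%R]|)%N.
Proof.
move=> g0 gb s0 bs; set X := [set x | _].
have X2 : (2 * #|~: X| <= #|J| ^ #|I|)%N.
  rewrite -(ler_nat R) -(ler_pM2l (exprn_gt0 2 s0)).
  apply: le_trans (ler_wpM2r (ler0n _ _) bs).
  rewrite natrM mulrCA -!(mulrA 2) ler_wpM2l //.
  apply: le_trans (second_moment _ g0 gb).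
  rewrite -sum1_card natr_sum mulr_sumr big_mkcond; apply: ler_sum => x _.
  rewrite !inE; case: ltP => [_|sx] /=; first exact: sqr_ge0.
  by rewrite mulr1 -[X in _ <= X]real_normK ?num_real // lerXn2r ?nnegrE // ltW.
have := cardsC X; rewrite card_ffun; lia.
Qed.

(** The squared length of a random point of the box [0, w)^d has mean of
    order [d w^2] but deviation only [sqrt d w^2]. *)
Lemma box_concentration (d w : nat) (sigma : R) : (0 < w)%N -> 0 < sigma ->
  2 * d%:R * (w%:R ^+ 2) ^+ 2 <= sigma ^+ 2 ->
  exists mu : R,
  (w ^ d <= 2 * #|[set x : {ffun 'I_d -> 'I_w} |
                    (`|(\sum_i x i ^ 2)%N%:R - mu| < sigma)%R]|)%N.
Proof.
move=> w0 s0 ws; have wR : 0 < w%:R :> R by rewrite ltr0n.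
pose m1 : R := (\sum_(t < w) t%:R ^+ 2) / w%:R.
have sq_le (t : 'I_w) : 0 <= (t%:R : R) ^+ 2 <= w%:R ^+ 2.
  by rewrite sqr_ge0 lerXn2r ?nnegrE // ler_nat ltnW.
have /andP[m0 mw] : 0 <= m1 <= w%:R ^+ 2.
  rewrite divr_ge0 ?sumr_ge0 //= ?ler_pdivrMr //.
  apply: (@le_trans _ _ (\sum_(t < w) w%:R ^+ 2)).
    by apply: ler_sum => t _; case/andP: (sq_le t).
  by rewrite sumr_const card_ord mulr_natr.
have g0 : \sum_(t < w) (t%:R ^+ 2 - m1) = 0.
  rewrite sumrB sumr_const card_ord -[m1 *+ w]mulr_natr divfK ?subrr //.
  by rewrite gt_eqF.
have gb (t : 'I_w) : `|t%:R ^+ 2 - m1| <= w%:R ^+ 2.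
  by have /andP[? ?] := sq_le t; rewrite ler_norml; apply/andP; split; lra.
exists (d%:R * m1).
have := @concentration 'I_d _ _ _ sigma g0 gb s0; rewrite !card_ord => /(_ ws) h.
apply: (leq_trans h); rewrite leq_mul2l /= subset_leq_card //.
apply/fintype.subsetP => x; rewrite !inE; congr (`|_| < _).
rewrite sumrB sumr_const card_ord mulr_natl natr_sum; congr (_ - _).
by apply: eq_bigr => i _; rewrite natrX.
Qed.

(** Double counting of pairs of a point and a translation [c]: each value of [F]
    in the interval of concentration lies in the translated shells for
    [#|A| d] values of [c], all of them among [K] consecutive integers. *)
Lemma popular_shells (X : finType) (F : X -> nat) (mu sigma : R) (L d D K : nat)
    (A : {set 'I_L}) :
  (#|X| <= 2 * #|[set x | (`|(F x)%:R - mu| < sigma)%R]|)%N ->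
  (d <= D)%N -> 2 * sigma + (L * D)%:R + 3 <= K%:R -> 0 <= sigma ->
  exists c : int,
    (#|X| * (#|A| * d) <= 2 * K *
      #|[set x | [exists a in A, exists e : 'I_d, ((F x)%:Z == c + (a * D + e)%N%:Z)%R]]|)%N.
Proof.
move=> typ dD KL s0.
(* the smallest translation for which the shells can meet the interval *)
pose lo : int := Num.floor (mu - sigma) - (L * D)%:Z.
have K0 : (0 < K)%N by rewrite -(ltr_nat R); have : 0 <= (L * D)%:R :> R by []; lra.
pose ok (c : 'I_K) x :=
  [exists a in A, exists e : 'I_d, (F x)%:Z == lo + c%:Z + (a * D + e)%N%:Z].
have many x : `|(F x)%:R - mu| < sigma -> (#|A| * d <= #|[set c | ok c x]|)%N.
  rewrite ltr_norml => /andP[Fl Fu].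
  pose cc (p : 'I_L * 'I_d) : int := (F x)%:Z - (p.1 * D + p.2)%N%:Z - lo.
  have ccK p : 0 <= cc p < K%:Z.
    have pL : (p.1 * D + p.2 < L * D)%N.
      have := ltn_ord p.1; have := ltn_ord p.2; nia.
    have /andP[fl fu] := mem_rg1_floor (mu - sigma).
    have Fx : (Num.floor (mu - sigma) <= (F x)%:Z).
      by rewrite -(ler_int R); apply: (le_trans fl); lra.
    rewrite /cc /lo; apply/andP; split; first by lia.
    rewrite -(ltr_int R) !(rmorphB, rmorphD) /=; move: KL fu pL.
    have : 0 <= (p.1 * D + p.2)%:R :> R by [].
    lra.
  have -> : (#|A| * d = #|finset.setX A [set: 'I_d]|)%N by rewrite cardsX cardsT card_ord.
  pose f p : 'I_K := insubd (Ordinal K0) `|cc p|%N.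
  have fE p : (f p : nat)%:Z = cc p.
    by have := ccK p; rewrite /f val_insubd => ?; rewrite ifT; lia.
  rewrite -(@card_in_imset _ _ f) => [|p q _ _ /(congr1 (fun i : 'I_K => (i : nat)%:Z))]; last first.
    rewrite /= !fE /cc => /addIr /addrI /oppr_inj [pq].
    have divD (z : 'I_L * 'I_d) : ((z.1 * D + z.2) %/ D = z.1)%N.
      have zD := leq_trans (ltn_ord z.2) dD.
      by rewrite divnMDl ?divn_small ?addn0 //; apply: leq_ltn_trans zD.
    have pq1 : p.1 = q.1 by apply: val_inj; rewrite /= -(divD p) -(divD q) pq.
    case: p q pq pq1 => [a e] [a' e'] /= pq aa'; rewrite aa' in pq *.
    by congr (_, _); apply: val_inj => /=; lia.
  apply/subset_leq_card/fintype.subsetP => c /imsetP[[a e]]; rewrite !inE /= => /andP[aA _] ->.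
  apply/existsP; exists a; rewrite aA; apply/existsP; exists e.
  by rewrite fE /cc /=; apply/eqP; lia.
have K1 : (0 < #|'I_K|)%N by rewrite card_ord.
have [|c h] := @exists_le_of_sum 'I_K
    (fun=> #|X| * (#|A| * d))%N (fun c => 2 * K * #|[set x | ok c x]|)%N K1; last first.
  by exists (lo + c%:Z).
rewrite sum_nat_const card_ord -big_distrr /= (mulnC 2 K) -[X in (_ <= X)%N]mulnA leq_mul2l.
  apply/orP; right; apply: leq_trans (leq_mul typ (leqnn _)) _.
  rewrite -mulnA leq_mul2l /= -sum_nat_const.
  under [X in (_ <= X)%N]eq_bigr => c _ do rewrite -sum1_card big_mkcond.
  rewrite exchange_big /= big_mkcond; apply: leq_sum => x _; rewrite inE.
  case: ifP => // /many; rewrite -[#|[set c | ok c x]|]sum1_card [X in (_ <= X)%N -> _]big_mkcond => h.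
  by apply: (leq_trans h); apply: leq_sum => c _; rewrite !inE.
Qed.
End SumOfSquares.

(** * Progressions whose points lie in shells *)

Lemma Zp_intr_eq0 (M : nat) (z : int) : (1 < M)%N ->
  z%:~R = 0 :> 'Z_M -> (M %| z)%Z.
Proof.
move=> M1 z0; rewrite dvdzE /= /dvdn.
have : (`|z|%N)%:R = 0 :> 'Z_M.
  by case: z z0 => n //=; rewrite NegzE mulrNz => /eqP; rewrite oppr_eq0 => /eqP.
by move=> /(congr1 (fun u : 'Z_M => u : nat)); rewrite val_Zp_nat //= => ->.
Qed.

Lemma row_mulrz (V : zmodType) (d : nat) (u : 'rV[V]_d) (z : int) i :
  (u *~ z) 0 i = u 0 i *~ z.
Proof. by case: z => n; rewrite ?NegzE ?mulrNz ?mxE -!pmulrn mulmxnE. Qed.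

(** [shrinks Q w e]: the dilate [e w] has a representative in Z^d of squared
    length at most [Q]. A coordinate is coded by its absolute value and its
    sign. *)
Definition shrinks (d M Q : nat) (w : 'rV['Z_M]_d) (e : int) : bool :=
  [exists y : {ffun 'I_d -> 'I_Q.+1 * bool}, (\sum_i (y i).1 ^ 2 <= Q)%N &&
     [forall i, w 0 i *~ e == (-1) ^+ (y i).2 * (y i).1%:R]].

Lemma shrinks_intro (d M Q : nat) (w : 'rV['Z_M]_d) (e : int) (z : 'I_d -> int) :
  \sum_i z i ^+ 2 <= Q%:Z -> (forall i, w 0 i *~ e = (z i)%:~R) -> shrinks Q w e.
Proof.
move=> zQ wz; apply/existsP; exists [ffun i => (inord `|z i|%N, z i < 0)].
have zQi i : (`|z i| < Q.+1)%N.
  have : z i ^+ 2 <= Q%:Z.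
    apply: le_trans zQ; rewrite (bigD1 i) //= lerDl sumr_ge0 // => l _.
    exact: sqr_ge0.
  by rewrite expr2; nia.
apply/andP; split.
  rewrite -lez_nat (le_trans _ zQ) // -[X in X <= _]natz natr_sum.
  apply: ler_sum => i _; rewrite ffunE /= inordK // natrX natz.
  by rewrite abszE real_normK ?num_real.
apply/forallP => i; rewrite ffunE /= inordK // wz; apply/eqP.
have [z0|z0] := ltrP (z i) 0.
  by rewrite expr1 mulN1r -[LHS]opprK -mulrNz; congr (- _); rewrite pmulrn; congr (_ *~ _); lia.
by rewrite expr0 mul1r pmulrn; congr (_ *~ _); lia.
Qed.

Lemma card_shrinks (d M Q : nat) (e : int) :
  e%:~R \is a (@GRing.unit 'Z_M) ->
  (#|[set w : 'rV['Z_M]_d | shrinks Q w e]|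
     <= #|[set y : {ffun 'I_d -> 'I_Q.+1 * bool} | \sum_i (y i).1 ^ 2 <= Q]|)%N.
Proof.
move=> eU; set Y := (X in (_ <= #|pred_of_set X|)%N).
pose f (y : {ffun 'I_d -> 'I_Q.+1 * bool}) : 'rV['Z_M]_d :=
  \row_i ((-1) ^+ (y i).2 * (y i).1%:R / e%:~R).
apply: leq_trans (leq_imset_card f Y).
apply/subset_leq_card/fintype.subsetP => w; rewrite inE => /existsP[y /andP[yQ /forallP yw]].
apply/imsetP; exists y; first by rewrite inE.
apply/rowP => i; rewrite mxE -(eqP (yw i)) -mulrzr mulrK //.
Qed.

(** The index sets in which polynomial sequences of degree at most [2 D] are
    constant; the degree [s <= D] is that of a curve, and [2 s] that of its
    squared length. *)
Definition rigid_indices (k D L : nat) (A : {set 'I_L}) : Prop :=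
  forall (b : nat -> 'I_L) (s : nat), (0 < s <= D)%N ->
  (forall j, (j < k)%N -> b j \in A) ->
  (forall j, (j + s.*2.+1 < k)%N -> fdiffn s.*2.+1 (fun l => (b l : nat)%:Z) j = 0) ->
  forall j, (j < k)%N -> b j = b 0%N.

Section ShellConstruction.
Variables (k D d M w L dl Dl : nat) (A : {set 'I_L}) (c : int).

Definition in_shells (v : {ffun 'I_d -> 'I_w}) : bool :=
  [exists a in A, exists e : 'I_dl,
     (\sum_i v i ^ 2)%N%:Z == c + (a * Dl + e)%N%:Z].

Definition shell_set : {set 'rV['Z_M]_d} :=
  [set \row_i ((v i : nat)%:R : 'Z_M) | v : {ffun 'I_d -> 'I_w} in [set v | in_shells v]].

Lemma card_shell_set : (1 < M)%N -> (w <= M)%N ->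
  #|shell_set| = #|[set v | in_shells v]|.
Proof.
move=> M1 wM; apply: card_imset => u v /rowP uv; apply/ffunP => i.
apply: val_inj => /=; have := uv i; rewrite !mxE => /(congr1 (fun z : 'Z_M => z : nat)).
by rewrite /= !val_Zp_nat // !modn_small //; apply: leq_trans (ltn_ord _) wM.
Qed.

(** The modulus exceeds [2^D] times the width of the box, so the
    representatives of a progression of points inherit its vanishing
    differences; its leading difference times [om] then has the short
    representative given by rigidity. *)
Lemma progression_in_shells (om al : 'rV['Z_M]_d) (a : nat -> int) (s : nat) :
  (1 < M)%N -> (2 ^ D * w < M)%N -> (D.*2 < k)%N -> (0 < s <= D)%N ->
  (2 ^ D.*2 * dl <= Dl)%N ->
  rigid_indices k D A ->
  (forall j, (j + s.+1 < k)%N -> fdiffn s.+1 a j = 0) ->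
  (forall j, (j < k)%N -> om *~ a j + al \in shell_set) ->
  shrinks (2 ^ D.*2 * dl) om (fdiffn s a 0).
Proof.
move=> M1 wM Dk s0D dD Afree a0 aT; have /andP[s0 sD] := s0D.
have k0 : (0 < k)%N by lia.
have L0 : (0 < L)%N.
  have /imsetP[v] := aT 0%N k0; rewrite inE => /existsP[[b bL] _] _; lia.
have /choice[v vE] : forall j, exists v : {ffun 'I_d -> 'I_w},
    (j < k)%N -> in_shells v /\ om *~ a j + al = \row_i ((v i : nat)%:R : 'Z_M).
  move=> j; case: (ltnP j k) => [jk|_].
    by have /imsetP[v] := aT j jk; rewrite inE => vs ->; exists v.
  have /imsetP[v _ _] := aT 0%N k0; by exists v.
have /choice[be beE] : forall j, exists be : 'I_L * nat, (j < k)%N ->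
    [/\ be.1 \in A, (be.2 < dl)%N &
      \sum_i (v j i : nat)%:Z ^+ 2 = c + (be.1 * Dl + be.2)%N%:Z].
  move=> j; case: (ltnP j k) => [jk|_]; last by exists (Ordinal L0, 0%N).
  have [/existsP[b /andP[bA /existsP[e /eqP E]]] _] := vE j jk.
  exists (b, e : nat) => _; split => //=; rewrite -E -[RHS]natz natr_sum.
  by apply: eq_bigr => i _; rewrite natrX natz.
pose x i j := (v j i : nat)%:Z.
have xE i t j : (j + t.+1 < k)%N ->
    (fdiffn t.+1 (x i) j)%:~R = om 0 i *~ fdiffn t.+1 a j :> 'Z_M.
  move=> jk; rewrite (raddf_fdiffn (intmul (1 : 'Z_M))).
  rewrite (@eq_fdiffn _ _ _ (fun l => om 0 i *~ a l + al 0 i)).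
    by rewrite fdiffnD fdiffn_const addr0 -(raddf_fdiffn (intmul (om 0 i))).
  move=> l /andP[_ lk]; have [|_] := vE l; first by lia.
  by move/rowP/(_ i); rewrite !mxE row_mulrz /x /= -pmulrn => <-.
have x0 i j : (j + s.+1 < k)%N -> fdiffn s.+1 (x i) j = 0.
  move=> jk; apply: (@fdiffn_dvd_eq0 M _ _ (w.-1)%:Z).
  - by move=> l _; have := ltn_ord (v l i); rewrite /x; lia.
  - rewrite -natrX natz; have : (2 ^ s <= 2 ^ D)%N by rewrite leq_exp2l.
    by have := ltn_ord (v 0%N i); nia.
  - by apply: Zp_intr_eq0 => //; rewrite xE // a0 // mulr0z.
apply: (@shrinks_intro _ _ _ _ _ (fun i => fdiffn s (x i) 0)); last first.
  by move=> i; case: s s0 sD {a0 x0 s0D} => // s _ sD; rewrite xE //; lia.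
have sDl : (2 ^ s.*2 * dl <= 2 ^ D.*2 * dl)%N.
  by rewrite leq_mul2r leq_exp2l ?orbT // leq_double sD orbT.
apply: le_trans (_ : (2 ^ s.*2 * dl)%N%:Z <= _); last by rewrite lez_nat.
apply: (@shells_rigidity _ k s x (fun j => (be j).1) (fun j => (be j).2) c dl Dl) => //.
- by rewrite (leq_ltn_trans _ Dk) // leq_double.
- by move=> j jk; have [] := beE j jk.
- by move=> j jk; have [] := beE j jk.
- exact: leq_trans dD.
- move=> b0 j jk; congr (nat_of_ord _).
  by apply: (Afree (fun j => (be j).1) s) => // l lk; have [] := beE l lk.
Qed.

End ShellConstruction.

(** * Density of the construction *)

(** Polynomial sequences of exact degree [s]: the difference of order [s] at 0 is
    [s!] times the leading coefficient. *)
Definition degree_progression (k s : nat) (a : nat -> int) : Prop :=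
  (forall j, (j + s.+1 < k)%N -> fdiffn s.+1 a j = 0) /\ fdiffn s a 0 <> 0.

Lemma Zp_unit_dvd_pred (M : nat) (e : int) : (1 < M)%N ->
  (e %| M.-1%:Z)%Z -> e%:~R \is a (@GRing.unit 'Z_M).
Proof.
move=> M1 /dvdzP[z zE]; apply/unitrPr; exists (- z)%:~R.
rewrite -intrM mulrN mulrC -zE mulrNz -pmulrn.
by apply/eqP; rewrite eqr_oppLR -subr_eq0 opprK natr1 prednK ?pchar_Zp // ltnW.
Qed.

(** One deleted element for each bad pair: its first component. *)
Lemma delete_heads (S : seq int) (P : seq (int * int)) (good : pred int)
    (bad : pred (int * int)) : uniq S ->
  (count good S <=
    size [seq s <- S | good s && (s \notin map fst (seq.filter bad P))] + count bad P)%N.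
Proof.
move=> uS; set H := map fst (seq.filter bad P).
apply: (@leq_trans (size [seq s <- S | good s && (s \notin H)] + size [seq s <- S | s \in H])).
  rewrite !size_filter -count_predUI (leq_trans _ (leq_addr _ _)) //.
  by apply: sub_count => s /= gs; case: (s \in H); rewrite ?orbT ?gs.
rewrite leq_add2l -size_filter -(size_map fst) -/H uniq_leq_size ?filter_uniq //.
by move=> s; rewrite mem_filter => /andP[].
Qed.

Lemma bernoulli_ineq (R : realDomainType) (x : R) d : 0 <= x <= 1 ->
  1 - d%:R * x <= (1 - x) ^+ d.
Proof.
move=> /andP[x0 x1]; elim: d => [|d IHd]; first by rewrite mul0r subr0.
rewrite exprS -natr1; apply: le_trans (ler_wpM2l _ IHd); last lra.
by have : 0 <= d%:R :> R by []; nra.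
Qed.

(** The modulus is 1 modulo every leading difference, so that these are
    invertible; it is one more than a multiple of [2^D], so that the box of side
    [w] almost has the largest side that rigidity allows. *)
Lemma good_modulus (R : realType) (d D : nat) (P : seq (int * int)) (kap : R) :
  (0 < d)%N -> (forall p, p \in P -> p.2 != 0) -> 0 < kap ->
  exists w : nat,
    let M := (2 ^ D * w).+1 in
    [/\ (1 < M)%N, (0 < w)%N, (forall p, p \in P -> (p.2 %| M.-1%:Z)%Z),
        2 <= kap * M%:R & (M ^ d <= 2 * (2 ^ (d * D) * w ^ d))%N].
Proof.
move=> d0 P0 kap0.
pose E := (\prod_(p <- P) `|p.2|)%N.
have E0 : (0 < E)%N.
  rewrite /E big_seq; apply: prodn_cond_gt0 => p pP.
  by rewrite absz_gt0 P0.
(* [M >= 2 d] makes [(w / M)^d] lose a factor 2 at most against [2^(- d D)],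
   by Bernoulli's inequality *)
pose q := (2 * d + (Num.truncn (2 / kap)).+1)%N.
have wq : (q <= E * q)%N by rewrite leq_pmull.
have q0 : (0 < q)%N by rewrite /q; lia.
exists (E * q)%N; move: (E * q)%N (dvdn_mulr q (dvdnn E)) wq => w Ew qw M.
have Mw : (w < M)%N by rewrite ltnS leq_pmull ?expn_gt0.
have MR : 0 < M%:R :> R by rewrite ltr0n.
have w0 := leq_trans q0 qw; have qM := leq_trans qw (ltnW Mw).
split; [exact: leq_ltn_trans Mw | by [] | | |].
- move=> p pP; rewrite dvdzE /=; apply: dvdn_mull; apply: dvdn_trans Ew.
  by rewrite /E (big_rem p) //= dvdn_mulr.
- rewrite mulrC -ler_pdivrMr //; apply: (le_trans (ltW (truncnS_gt _))).
  by rewrite ler_nat (leq_trans _ qM) // leq_addl.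
- rewrite (mulnC d D) expnM -expnMn -(ler_nat R) natrM !natrX -[(2 ^ D * w)%N]/(M.-1).
  have -> : (M.-1)%:R = M%:R * (1 - M%:R^-1) :> R.
    by rewrite mulrBr mulr1 divff ?gt_eqF // -subn1 natrB.
  rewrite exprMn mulrCA ler_peMr ?exprn_ge0 //.
  have M1 : M%:R^-1 <= 1 :> R by rewrite invf_le1 // ler1n.
  have := @bernoulli_ineq R M%:R^-1 d; rewrite invr_ge0 ltW // M1 => /(_ isT).
  have : d%:R * M%:R^-1 <= 2^-1 :> R; last by lra.
  by rewrite ler_pdivrMr // mulrC ler_pdivlMr // -natrM ler_nat mulnC (leq_trans _ qM) ?leq_addr.
Qed.

(** [N] and [n] are the sizes of [S] and of the subset found, [g] that of the
    group, [t] the number of its points in shells, [wd] the volume of the box,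
    [dl] the width of a shell, [PB] a bound for the bad events, [K] the number
    of translations, and [M2] the square of the modulus. *)
Lemma density_bookkeeping (R : realDomainType)
    (N n g t a wd dl K k2d M2 Y E F PB : R) :
  0 <= N -> 0 <= n -> 0 < g -> 0 < M2 -> 0 <= t -> 0 <= a -> 0 <= wd -> 0 <= E ->
  0 <= F -> 0 <= Y -> g <= 2 * (E * wd) -> wd * (a * dl) <= 2 * K * t ->
  N * t * g <= n * g ^+ 2 + PB * t -> 2 * PB <= N * g ->
  k2d * M2 <= 2 * dl -> 0 <= k2d -> K <= 8 * F * (M2 * Y) ->
  N * (a * k2d) <= n * (128 * E * F * Y).
Proof.
move=> N0 n0 g0 M0 t0 a0 w0 E0 F0 Y0 gE ta tn PBN kM k0 KY.
have Nt : N * t <= 2 * n * g.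
  rewrite -(ler_pM2r g0); have := ler_wpM2r t0 PBN.
  rewrite expr2 in tn; lra.
rewrite -(ler_pM2r (mulr_gt0 g0 M0)).
have s1 : N * (a * k2d) * (g * M2) <= N * a * (2 * dl) * (2 * (E * wd)).
  rewrite (_ : _ * (g * M2) = N * a * ((k2d * M2) * g)); last by ring.
  by rewrite -[X in _ <= X]mulrA ler_wpM2l ?mulr_ge0 // ler_pM ?mulr_ge0 ?(ltW g0) ?(ltW M0).
have s2 : N * a * (2 * dl) * (2 * (E * wd)) <= 4 * E * N * (2 * K * t).
  rewrite (_ : N * a * _ * _ = 4 * E * N * (wd * (a * dl))); last by ring.
  by rewrite ler_wpM2l ?mulr_ge0.
have s3 : 4 * E * N * (2 * K * t) <= 8 * E * (N * t) * (8 * F * (M2 * Y)).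
  rewrite (_ : 4 * E * N * _ = 8 * E * (N * t) * K); last by ring.
  by rewrite ler_wpM2l ?mulr_ge0.
apply: (le_trans s1); apply: (le_trans s2); apply: (le_trans s3).
rewrite (_ : n * _ * _ = 8 * E * (2 * n * g) * (8 * F * (M2 * Y))); last by ring.
by rewrite ler_wpM2r ?mulr_ge0 ?(ltW M0) // ler_wpM2l ?mulr_ge0.
Qed.

Section Core.
Variables (R : realType) (k D d L : nat) (A : {set 'I_L}).
Variables (S : seq int) (P : seq (int * int)) (Psi kap : R).
Hypotheses (D0 : (0 < D)%N) (d0 : (0 < d)%N) (Dk : (D.*2 < k)%N) (uS : uniq S).
Hypothesis Afree : rigid_indices k D A.
Hypothesis P_neq0 : forall p, p \in P -> p.2 != 0.
Hypothesis P_type : forall (a : nat -> int) (s : nat), (0 < s <= D)%N ->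
  (forall j, (j < k)%N -> a j \in S) -> degree_progression k s a ->
  (a 0%N, fdiffn s a 0) \in P.
Hypothesis P_size : (size P)%:R <= (size S)%:R * Psi.
Hypotheses (kap0 : 0 < kap).
Hypothesis kapP : 2 * Psi * (12 * expR 1 * 2 ^+ D * kap) ^+ d <= 1.

(** If a progression survives, its leading difference is shrunk by [om] and its
    first term is kept, so that this first term was deleted. *)
Lemma discrete_construction (M w dl Dl B : nat) (c : int) :
  (1 < M)%N -> (2 ^ D * w < M)%N -> (forall p, p \in P -> (p.2 %| M.-1%:Z)%Z) ->
  (2 ^ D.*2 * dl <= Dl)%N ->
  (#|[set y : {ffun 'I_d -> 'I_(2 ^ D.*2 * dl).+1 * bool} |
       (\sum_i (y i).1 ^ 2 <= 2 ^ D.*2 * dl)%N]| <= B)%N ->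
  let t := #|[set v : {ffun 'I_d -> 'I_w} | in_shells dl Dl A c v]| in
  exists S' : seq int,
    [/\ subseq S' S,
        forall a s, (0 < s <= D)%N -> (forall j, (j < k)%N -> a j \in S') ->
          ~ degree_progression k s a &
        (size S * t * M ^ d <= size S' * (M ^ d) ^ 2 + size P * B * t)%N].
Proof.
move=> M1 wM PM dD yB t.
have gE : #|{: 'rV['Z_M]_d}| = (M ^ d)%N by rewrite card_mx mul1n card_ord Zp_cast.
have wM' : (w <= M)%N by apply: leq_trans (ltnW wM); rewrite leq_pmull ?expn_gt0.
have tE := @card_shell_set d M w L dl Dl A c M1 wM'.
have shB p : p \in P -> (#|[set om | @shrinks d M (2 ^ D.*2 * dl) om p.2]| <= B)%N.
  by move=> /PM pM; apply: leq_trans (card_shrinks _ _ _) yB; apply: Zp_unit_dvd_pred.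
have [om [al]] := random_affine_map (shell_set d M w dl Dl A c) S shB.
rewrite gE tE -/t; set good := fun s : int => _; set bad := fun p : int * int => _ && _.
have := delete_heads P good bad uS; set S' := [seq _ <- _ | _] => hS' h.
exists S'; split; first exact: filter_subseq.
- move=> a s sD aS' [a0 e0]; have k0 : (0 < k)%N by lia.
  have aS j : (j < k)%N -> a j \in S by move/aS'; rewrite mem_filter => /andP[].
  have aT j : (j < k)%N -> om *~ a j + al \in shell_set d M w dl Dl A c.
    by move/aS'; rewrite mem_filter => /andP[/andP[]].
  have aP := P_type sD aS (conj a0 e0).
  have := aS' 0%N k0; rewrite mem_filter => /andP[/andP[_ /negP aH] _]; apply: aH.
  apply/mapP; exists (a 0%N, fdiffn s a 0) => //; rewrite mem_filter aP andbT /bad /=.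
  rewrite aT //=; apply: progression_in_shells aT => //.
  
- rewrite -(leq_add2r (count bad P * (M ^ d) ^ 2)) (leq_trans h) // addnAC leq_add2r.
  by rewrite -mulnDl leq_mul2r hS' orbT.
Qed.

(** The parameters in terms of [M]: the width of a shell is [kap^2 d M^2], the
    representatives of bad dilates have squared length at most [4^D] times
    this, hence at most [m^2 d] with [m] just above [2^D kap M], and such vectors
    number at most [(12 e 2^D kap M)^d]. The hypothesis [kapP] says that they are a
    proportion at most [1 / (2 Psi)] of the group. *)
Lemma shell_construction :
  exists S' : seq int,
    [/\ subseq S' S,
        forall a s, (0 < s <= D)%N -> (forall j, (j < k)%N -> a j \in S') ->
          ~ degree_progression k s a &
        (size S)%:R * (#|A|%:R * (kap ^+ 2 * d%:R))
          <= (size S')%:R * (128 * 2 ^+ (d * D) * 4 ^+ D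
               * (Num.sqrt d%:R + L%:R * (kap ^+ 2 * d%:R)))].
Proof.
have [w] := good_modulus D d0 P_neq0 kap0; set M := _.+1 => -[M1 w0 PM kapM Mw].
have MR : 0 < M%:R :> R by rewrite ltr0n.
have dR : 1 <= d%:R :> R by rewrite ler1n.
pose y : R := kap ^+ 2 * d%:R * M%:R ^+ 2.
pose dl := Num.truncn y.
pose Dl := (2 ^ D.*2 * dl)%N.
have y4 : 4 <= y.
  rewrite /y mulrAC -exprMn; apply: (@le_trans _ _ ((kap * M%:R) ^+ 2)).
    by rewrite expr2; nra.
  by rewrite ler_peMr ?sqr_ge0.
have y0 : 0 <= y by lra.
have [dl_le dl_gt] : dl%:R <= y /\ y < dl%:R + 1.
  by have /andP[? ?] := truncn_itv y0; rewrite natr1.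
have Dl_le : Dl%:R <= 4 ^+ D * y.
  rewrite /Dl natrM -muln2 mulnC expnM natrX ler_wpM2l // exprn_ge0 //.
pose m := (Num.truncn (2 ^+ D * kap * M%:R)).+1.
have kM : 2 <= 2 ^+ D * kap * M%:R.
  by rewrite -mulrA (le_trans kapM) // ler_peMl ?exprn_ege1 ?ler1n //; lra.
have m_le : m%:R <= 2 * (2 ^+ D * kap * M%:R).
  by have /andP[? ?] := truncn_itv (le_trans (ler0n R 2) kM); rewrite /m -natr1; lra.
have m_gt : 2 ^+ D * kap * M%:R <= m%:R by exact: ltW (truncnS_gt _).
have Qm : (2 ^ D.*2 * dl <= m ^ 2 * d)%N.
  rewrite -(ler_nat R) (le_trans Dl_le) // natrM natrX.
  apply: (@le_trans _ _ ((2 ^+ D * kap * M%:R) ^+ 2 * d%:R)).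
    have -> : 4 ^+ D = (2 ^+ D) ^+ 2 :> R by rewrite -exprM mulnC exprM expr2 -natrM.
    by rewrite /y le_eqVlt; apply/orP; left; apply/eqP; ring.
  by rewrite ler_wpM2r // lerXn2r ?nnegrE //; lra.
set B := #|[set v : {ffun 'I_d -> 'I_(2 ^ D.*2 * dl).+1 * bool} |
       (\sum_i (v i).1 ^ 2 <= 2 ^ D.*2 * dl)%N]|.
have hB : 2 * Psi * B%:R <= (M ^ d)%:R.
  have [P0|P0] := lerP Psi 0.
    by apply: (@le_trans _ _ 0) => //; rewrite mulr_le0_ge0 // pmulr_rle0.
  apply: (@le_trans _ _ (2 * Psi * ((12 * expR 1 * 2 ^+ D * kap) * M%:R) ^+ d)).
    rewrite ler_wpM2l //; first by lra.
    apply: (le_trans (@card_lattice_ball R d m _ _ (ltn0Sn _) Qm)).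
    have e0 := expR_gt0 (1 : R); have m0 : 0 <= m%:R :> R by [].
    have kM0 : 0 <= 2 ^+ D * kap * M%:R by lra.
    have emk : expR 1 * (6 * m%:R) <= 12 * expR 1 * 2 ^+ D * kap * M%:R.
      have -> : 12 * expR 1 * 2 ^+ D * kap * M%:R
        = expR 1 * (6 * (2 * (2 ^+ D * kap * M%:R))) by ring.
      by rewrite ler_wpM2l ?expR_ge0 // ler_wpM2l.
    have em0 : 0 <= expR 1 * (6 * m%:R) :> R by rewrite mulr_ge0 ?expR_ge0 ?mulr_ge0.
    by rewrite lerXn2r ?nnegrE // (le_trans em0).
  by rewrite exprMn mulrA natrX ler_piMl // exprn_ge0 // ltW.
pose s := Num.sqrt (d%:R : R).
have s1 : 1 <= s by rewrite -[1]sqrtr1 ler_wsqrtr.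
have s2 : s ^+ 2 = d%:R by rewrite sqr_sqrtr.
pose sigma : R := 2 * s * w%:R ^+ 2.
have wR : 1 <= w%:R :> R by rewrite ler1n.
have sg0 : 0 < sigma by rewrite /sigma !mulr_gt0 ?exprn_gt0 //; lra.
have [mu hmu] : exists mu : R, (w ^ d <= 2 * #|[set x : {ffun 'I_d -> 'I_w} |
                    (`|(\sum_i x i ^ 2)%N%:R - mu| < sigma)%R]|)%N.
  apply: box_concentration => //; rewrite /sigma !exprMn s2 ler_wpM2r ?sqr_ge0 //; nra.
pose K := (Num.truncn (2 * sigma + (L * Dl)%:R)).+4.
have sL0 : 0 <= 2 * sigma + (L * Dl)%:R by rewrite addr_ge0 // mulr_ge0 // ltW.
have /andP[K1 K2] := truncn_itv sL0.
have KE : K%:R = (Num.truncn (2 * sigma + (L * Dl)%:R))%:R + 4 :> R by rewrite /K -natrD addn4.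
have KL : 2 * sigma + (L * Dl)%:R + 3 <= K%:R.
  by rewrite KE; move: K2; rewrite -natr1; lra.
set Y := s + L%:R * (kap ^+ 2 * d%:R).
have K_le : K%:R <= 8 * 4 ^+ D * (M%:R ^+ 2 * Y).
  have wM : w%:R <= M%:R :> R by rewrite ler_nat ltnW // ltnS leq_pmull ?expn_gt0.
  have w2 : w%:R ^+ 2 <= M%:R ^+ 2 :> R by rewrite lerXn2r ?nnegrE.
  have M2 : 1 <= M%:R ^+ 2 :> R by apply: (le_trans _ w2); rewrite exprn_ege1.
  have D4 : 1 <= 4 ^+ D :> R by rewrite exprn_ege1 // ler1n.
  have sM : 1 <= s * M%:R ^+ 2 by rewrite (le_trans s1) // ler_peMr //; lra.
  have sgM : 2 * sigma <= 4 * (s * M%:R ^+ 2).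
    by have : s * w%:R ^+ 2 <= s * M%:R ^+ 2; [rewrite ler_wpM2l //; lra | rewrite /sigma; lra].
  have LD : (L * Dl)%:R <= 4 ^+ D * (L%:R * y).
    by rewrite natrM mulrCA ler_wpM2l.
  have -> : M%:R ^+ 2 * Y = s * M%:R ^+ 2 + L%:R * y by rewrite /Y /y; ring.
  have Ly : 0 <= L%:R * y by rewrite mulr_ge0.
  have sM4 : s * M%:R ^+ 2 <= 4 ^+ D * (s * M%:R ^+ 2) by rewrite ler_peMl //; lra.
  have Ly4 : 0 <= 4 ^+ D * (L%:R * y) by rewrite mulr_ge0 ?exprn_ge0.
  by rewrite KE -mulrA mulrDr mulrDr; lra.
have dlDl : (dl <= Dl)%N by rewrite leq_pmull ?expn_gt0.
have [c hc] := @popular_shells R {ffun 'I_d -> 'I_w} (fun x => \sum_i x i ^ 2)%N mu sigma L dl Dl K A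
  ltac:(by rewrite card_ffun !card_ord) dlDl KL (ltW sg0).
have [S' [sub free cnt]] := discrete_construction c M1 (ltnSn _) PM (leqnn Dl) (leqnn B).
exists S'; split => //.
move: hc cnt; rewrite card_ffun !card_ord.
rewrite -[[set x | _]]/[set v | in_shells dl Dl A c v]; set t := #|[set v | in_shells dl Dl A c v]|.
move=> tc cnt; have Y0 : 0 <= Y.
  by rewrite addr_ge0 ?sqrtr_ge0 // mulr_ge0 // mulr_ge0 // sqr_ge0.
apply: (@density_bookkeeping R _ _ (M ^ d)%:R t%:R _ (w ^ d)%:R dl%:R K%:R _
  (M%:R ^+ 2) Y _ (4 ^+ D) ((size P)%:R * B%:R)) => //.
- by rewrite ltr0n expn_gt0.
- exact: exprn_gt0.
- by have := Mw; rewrite -(ler_nat R) !natrM [(2 ^ (d * D))%:R]natrX.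
- by have := tc; rewrite -(ler_nat R) !natrM.
- by have := cnt; rewrite -(ler_nat R) natrD !natrM expr2.
- have := ler_wpM2r (ler0n R B) P_size.
  have := ler_wpM2l (ler0n R (size S)) hB; lra.
- by rewrite -/y; lra.
- by rewrite mulr_ge0 ?sqr_ge0.
Qed.
End Core.

(** * Real progressions and integer differences *)

(** The default value outside the window [j < k] is never seen by the
    differences in use. *)
Definition extend (k : nat) (a : 'I_k -> int) (j : nat) : int :=
  oapp a 0 (insub j).

Lemma extendE k (a : 'I_k -> int) (i : 'I_k) : extend a i = a i.
Proof. by rewrite /extend valK. Qed.

Lemma extend_lt k (a : 'I_k -> int) j (jk : (j < k)%N) : extend a j = a (Ordinal jk).
Proof. by rewrite -[j]/(nat_of_ord (Ordinal jk)) extendE. Qed.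

Lemma generates_degree_progression (R : realType) (k D : nat) (Q : {poly R})
    (a : 'I_k -> int) :
  (D < k)%N -> generates D Q a ->
  exists s, [/\ (0 < s <= D)%N, degree_progression k s (extend a) &
    type_of Q = (s, (extend a 0)%:~R, (fdiffn s (extend a) 0)%:~R)].
Proof.
move=> Dk [/andP[Q1 QD] Qa]; exists (size Q).-1.
have sD : (0 < (size Q).-1 <= D)%N by move: (size Q) Q1 QD => [|[|q]].
have Q0 : (size Q).-1.+1 = size Q by rewrite prednK // (leq_trans _ Q1).
have sk : (0 + (size Q).-1 < k)%N by case/andP: sD => _ /leq_ltn_trans; apply.
have aQ t j : (j + t < k)%N ->
    (fdiffn t (extend a) j)%:~R = fdiffn t (fun l => Q.[1 + l%:R]) j.
  move=> jk; rewrite (raddf_fdiffn (intmul (1 : R))).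
  apply: eq_fdiffn => l /andP[_ lt]; have lk : (l < k)%N by lia.
  by rewrite nat1r /= (extend_lt a lk) -Qa.
have e_lead : (fdiffn (size Q).-1 (extend a) 0)%:~R = (size Q).-1`!%:R * lead_coef Q.
  by rewrite aQ // fdiffn_horner ?Q0.
split=> //; last first.
  rewrite /type_of e_lead; congr (_, _, _).
  by have := aQ 0%N 0%N (leq_ltn_trans (leq0n _) Dk); rewrite /fdiffn /= addr0.
split=> [j jk|].
  by apply/eqP; rewrite -(intr_eq0 R) aQ // fdiffn_horner0 // Q0.
move/(congr1 (fun z : int => z%:~R : R)); rewrite e_lead mulr0z => /eqP.
rewrite mulf_eq0 pnatr_eq0 eqn0Ngt fact_gt0 /=.
by rewrite lead_coef_eq0 -size_poly_eq0 -Q0.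
Qed.

Lemma degree_progression_generates (R : realType) (k D s : nat) (a : nat -> int) :
  (0 < s <= D)%N -> (s < k)%N -> degree_progression k s a ->
  nonconstant (fun i : 'I_k => a i) /\
  exists2 Q : {poly R}, generates D Q (fun i : 'I_k => a i) &
    type_of Q = (s, (a 0%N)%:~R, (fdiffn s a 0)%:~R).
Proof.
move=> /andP[s0 sD] sk [a0 e0]; split.
  apply: contrapT => nc; apply: e0.
  have ac j : (j < k)%N -> a j = a 0%N.
    move=> jk; apply: contrapT => aj; apply: nc.
    by exists (Ordinal jk), (Ordinal (ltn_trans s0 sk)).
  rewrite (@eq_fdiffn _ _ _ (fun=> a 0%N)) => [|l /andP[_ ls]]; last by rewrite ac //; lia.
  by case: s s0 {sD sk a0} => // s _; rewrite fdiffn_const.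
have [P sP Pa] := interpolate R a0; pose Q := P \Po ('X - 1%:P).
have Qa j : (j < k)%N -> Q.[j.+1%:R] = (a j)%:~R.
  by move=> jk; rewrite /Q horner_comp !hornerE -natr1 addrK Pa.
have sQP : size Q = size P by rewrite size_comp_poly2 ?size_XsubC.
have Qs : (fdiffn s a 0)%:~R = s`!%:R * Q`_s.
  rewrite -(@fdiffn_horner _ Q s 1 0) ?sQP // (raddf_fdiffn (intmul (1 : R))).
  by apply: eq_fdiffn => l /andP[_ ls]; rewrite nat1r /= Qa //; lia.
have sQ : size Q = s.+1.
  apply/eqP; rewrite eqn_leq sQP sP -sQP ltnNge; apply/negP => Qle.
  move/eqP: Qs; rewrite nth_default // mulr0 intr_eq0 => /eqP; exact: e0.
exists Q.
  by split=> [|i]; [rewrite sQ ltnS s0 | rewrite Qa].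
rewrite /type_of sQ /= /lead_coef sQ /= -Qs; congr (_, _, _).
by rewrite -Qa ?(ltn_trans s0).
Qed.

(** Repeatedly lowering the order of vanishing differences ends at the exact
    degree. *)
Lemma constant_or_degree_progression (k t : nat) (a : nat -> int) :
  (forall j, (j + t < k)%N -> fdiffn t a j = 0) ->
  (forall j, (j < k)%N -> a j = a 0%N) \/
  exists2 s, (0 < s < t)%N & degree_progression k s a.
Proof.
elim: t => [|t IHt] at0.
  left=> j jk; rewrite -[a j]/(fdiffn 0 a j) -[a 0%N]/(fdiffn 0 a 0) !at0 //; lia.
have cst j : (j + t < k)%N -> fdiffn t a j = fdiffn t a 0.
  elim: j => [//|j IHj] jk; rewrite -IHj; last by lia.
  by apply/eqP; rewrite -subr_eq0 -fdiffnS at0 //; lia.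
have [f0|/eqP f0] := eqVneq (fdiffn t a 0) 0.
  case: IHt => [j jk|?|[s /andP[s0 st] sa]]; [by rewrite cst | by left |].
  by right; exists s; rewrite // s0 ltnS ltnW.
case: t at0 cst f0 {IHt} => [|t] at0 cst f0.
  by left=> j jk; apply: cst; rewrite addn0.
by right; exists t.+1; rewrite ?ltnSn.
Qed.

Section ProgressionFree.
Variables (R : realType) (k D : nat).

Lemma leq_rkD (A S : {fset int}) :
  (A `<=` S)%fset -> progression_free R k D A -> (#|` A| <= rkD R k D S)%N.
Proof.
move=> AS Af; rewrite /rkD; apply: (@leq_bigmax_seq _ _ _ (fun A : {fset int} => #|` A|)).
  by rewrite -[_ \in _]/(A \in fpowerset S) fpowersetE.
exact/asboolP.
Qed.

Lemma rkD_attained (S : {fset int}) : (0 < k)%N ->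
  exists A : {fset int},
    [/\ (A `<=` S)%fset, progression_free R k D A & #|` A| = rkD R k D S].
Proof.
move=> k0.
have f0 : progression_free R k D fset0.
  by move=> [a [_ /(_ (Ordinal k0))]]; rewrite inE.
pose good (A : {fset int}) := (A \in fpowerset S) && `[< progression_free R k D A >].
have : exists A, good A && (#|` A| == rkD R k D S).
  rewrite /rkD big_seq_cond -/(good _); elim/big_ind: _.
  - by exists fset0; rewrite /good fpowersetE fsub0set cardfs0 eqxx andbT; apply/asboolP.
  - move=> m n [A Am] [B Bn]; by case: leqP => mn; [exists B | exists A].
  - by move=> A gA; exists A; rewrite eqxx andbT.
move=> [A /andP[/andP[AS /asboolP Af] /eqP AE]]; exists A; split=> //.
by rewrite -fpowersetE.
Qed.

End ProgressionFree.

Lemma progression_free_constant (R : realType) (k D L s : nat) (A : {fset int})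
    (b : nat -> 'I_L) :
  (D < k)%N -> progression_free R k D A -> (s <= D)%N ->
  (forall j, (j < k)%N -> (b j : nat)%:Z \in A) ->
  (forall j, (j + s.+1 < k)%N -> fdiffn s.+1 (fun l => (b l : nat)%:Z) j = 0) ->
  forall j, (j < k)%N -> b j = b 0%N.
Proof.
move=> Dk Af sD bA /constant_or_degree_progression[cst j jk|[t /andP[t0 ts] tb]].
  by apply: val_inj; have [] := cst j jk.
have tD : (0 < t <= D)%N by rewrite t0 (leq_trans _ sD).
have tk : (t < k)%N by rewrite (leq_ltn_trans _ Dk) // (leq_trans _ sD).
have [nc [Q Qb _]] := degree_progression_generates R tD tk tb.
case: Af; exists (fun i : 'I_k => (b i : nat)%:Z); split=> [|i].
  by split=> //; exists Q.
exact: bA.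
Qed.

Lemma mem_fset_setE (T : choiceType) (X : set T) x :
  finite_set X -> (x \in fset_set X) -> X x.
Proof. by move=> fX; rewrite in_fset_set // => /set_mem. Qed.

(** Types with the exact degree forgotten: the deletion argument uses only the
    first term and the leading difference, which are integers. *)
Definition type_pairs (R : realType) (k D : nat) (S : {fset int}) : seq (int * int) :=
  [seq p <- [seq (Num.floor t.1.2, Num.floor t.2) | t <- fset_set (types (R := R) k D S)]
     | p.2 != 0].

Lemma size_type_pairs (R : realType) k D S :
  (size (type_pairs R k D S) <= TypekD R k D S)%N.
Proof. by rewrite size_filter (leq_trans (count_size _ _)) // size_map. Qed.

Lemma mem_type_pairs (R : realType) k D S (a : nat -> int) s :
  (D < k)%N -> (0 < s <= D)%N -> (forall j, (j < k)%N -> a j \in S) ->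
  degree_progression k s a -> (a 0%N, fdiffn s a 0) \in type_pairs R k D S.
Proof.
move=> Dk sD aS ap; rewrite mem_filter /=; apply/andP; split.
  by apply/eqP; case: ap.
have sk : (s < k)%N by case/andP: sD => _ /leq_ltn_trans; apply.
have [nc [Q Qa tE]] := degree_progression_generates R sD sk ap.
apply/mapP; exists (type_of Q); last by rewrite tE /= !intrKfloor.
rewrite in_fset_set; last exact: finite_types.
apply/mem_set; exists (fun i : 'I_k => a i), Q; split=> // i.
exact: aS.
Qed.

(** The box has density [2^(- d D)] in the group, and the squared lengths spread
    over [sqrt d] in units of [M^2], against [kap^2 d] for one shell; [L] spaced
    shells may take more room than [sqrt d], whence the sum on the right. *)
Lemma rkD_ge_shells (R : realType) (k D d L : nat) (A S : {fset int}) (Psi kap : R) :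
  (0 < D)%N -> (0 < d)%N -> (D.*2 < k)%N ->
  (forall z, z \in A -> 0 <= z < L%:Z) -> progression_free R k D.*2 A ->
  (TypekD R k D S)%:R <= (#|` S|)%:R * Psi ->
  0 < kap -> 2 * Psi * (12 * expR 1 * 2 ^+ D * kap) ^+ d <= 1 ->
  (#|` S|)%:R * (#|` A|%:R * (kap ^+ 2 * d%:R)) <=
    (rkD R k D S)%:R * (128 * 2 ^+ (d * D) * 4 ^+ D
               * (Num.sqrt d%:R + L%:R * (kap ^+ 2 * d%:R))).
Proof.
move=> D0 d0 Dk AL Af TS kap0 kapP.
have Dk1 : (D < k)%N by lia.
pose A' : {set 'I_L} := [set i : 'I_L | (i : nat)%:Z \in A].
have AA' : (#|` A| <= #|A'|)%N.
  rewrite cardE -(size_map (fun i : 'I_L => (i : nat)%:Z)).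
  apply: uniq_leq_size => [|z zA]; first exact: fset_uniq.
  have /andP[z0 zL] := AL z zA; have zL' : (`|z| < L)%N by lia.
  apply/mapP; exists (Ordinal zL'); last by rewrite /=; lia.
  by rewrite mem_enum inE /= gez0_abs.
have [||||||S' [sub free cnt]] := @shell_construction R k D d L A' S (type_pairs R k D S) Psi kap D0 d0 Dk (fset_uniq S).
- move=> b s sD bA b0; apply: (progression_free_constant Dk Af (s := s.*2)) => //.
    by rewrite leq_double; case/andP: sD.
  by move=> j /bA; rewrite inE.
- by move=> p; rewrite mem_filter => /andP[].
- by move=> a s sD aS ap; apply: mem_type_pairs.
- by apply: le_trans TS; rewrite ler_nat size_type_pairs.
- exact: kap0.
- exact: kapP.
have k2d0 : 0 <= kap ^+ 2 * d%:R by rewrite mulr_ge0 ?sqr_ge0.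
apply: (@le_trans _ _ ((#|` S|)%:R * (#|A'|%:R * (kap ^+ 2 * d%:R)))).
  by rewrite ler_wpM2l // ler_wpM2r // ler_nat.
apply: (le_trans cnt); rewrite ler_wpM2r //.
  by rewrite mulr_ge0 // addr_ge0 ?sqrtr_ge0 // mulr_ge0.
have uS' : uniq S' := subseq_uniq sub (fset_uniq S).
have <- : #|` [fset x in S']%fset| = size S' by rewrite card_fseq undup_id.
rewrite ler_nat; apply: leq_rkD.
  by apply/fsubsetP => x; rewrite inE => /(mem_subseq sub).
move=> [a [[nc [Q Qa]] aS]]; have [s [sD sp _]] := generates_degree_progression Dk1 Qa.
apply: (free (extend a) s sD) sp => j jk.
by rewrite extend_lt; have := aS (Ordinal jk); rewrite inE.
Qed.

Definition initial_segment (L : nat) : {fset int} :=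
  [fset x in [seq Posz i | i <- iota 0 L]]%fset.

Lemma mem_initial_segment L (z : int) : (z \in initial_segment L) = (0 <= z < L%:Z).
Proof.
rewrite !inE; apply/mapP/idP => [[i]|/andP[z0 zL]].
  by rewrite mem_iota => ? ->; lia.
by exists `|z|%N; [rewrite mem_iota; lia | rewrite gez0_abs].
Qed.

Lemma card_initial_segment L : #|` initial_segment L| = L.
Proof.
rewrite card_fseq undup_id ?size_map ?size_iota //.
by rewrite map_inj_uniq ?iota_uniq // => i j [].
Qed.

(** First terms are in [[0, L)] and leading differences are [O(L)], so [O(L^2)]
    types. *)
Lemma types_initial_segment (R : realType) (k D L : nat) :
  (D < k)%N -> (0 < L)%N ->
  (TypekD R k D (initial_segment L) <= L * (D.+1 * 2 ^ D.+2 * L))%N.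
Proof.
move=> Dk L0; rewrite /TypekD.
(* the leading difference is coded with the offset [2^D L] *)
pose f (p : 'I_D.+1 * 'I_L * 'I_(2 ^ D.+2 * L)) : nat * R * R :=
  (p.1.1 : nat, (p.1.2 : nat)%:R, (p.2 : nat)%:R - (2 ^ D * L)%:R).
apply: (@leq_trans (size (codom f))); last first.
  by rewrite size_codom !card_prod !card_ord; lia.
apply: uniq_leq_size => [|t]; first exact: fset_uniq.
move/(mem_fset_setE (finite_types _ _ Dk)) => [a [Q [_ Qa aS ->]]].
have [s [sD sp ->]] := generates_degree_progression Dk Qa.
have aL j : (j < k)%N -> 0 <= extend a j < L%:Z.
  by move=> jk; rewrite extend_lt -mem_initial_segment.
have := aL 0%N (leq_ltn_trans (leq0n _) Dk).
set b := extend a 0 => /andP[b0 bL].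
have : `|fdiffn s (extend a) 0| <= (2 ^ D * L)%N%:Z.
  case: s sD {sp} => // s /andP[_ sD].
  apply: (le_trans (@fdiffn_bound _ _ _ L%:Z _ _)) => [j /andP[_ js]|].
    by have /andP[-> /ltW ->] := aL j ltac:(lia).
  by rewrite -natrX natz -PoszM lez_nat leq_mul2r leq_exp2l // ltnW // orbT.
set e := fdiffn _ _ _ => eL.
have bL' : (`|b| < L)%N by lia.
have eL' : (`|(e + (2 ^ D * L)%N%:Z)%R| < 2 ^ D.+2 * L)%N.
  by move: eL; rewrite !expnS; have := expn_gt0 2 D; nia.
have sD' : (s < D.+1)%N by case/andP: sD.
apply/codomP; exists (Ordinal sD', Ordinal bL', Ordinal eL'); rewrite /f /=.
congr (_, _, _).
  by rewrite pmulrn gez0_abs.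
rewrite !pmulrn gez0_abs; last by move: eL; lia.
by rewrite rmorphD addrK.
Qed.

(** * The exponent and the optimal dimension *)

Section Asymptotics.
Variable R : realType.
Implicit Types (x y Lg : R).

Lemma exp2E x : exp2 x = expR (x * ln 2).
Proof. by rewrite /exp2 /powR gt_eqF. Qed.

Lemma exp2_gt0 x : 0 < exp2 x.
Proof. exact: powR_gt0. Qed.

Lemma exp2D x y : exp2 (x + y) = exp2 x * exp2 y.
Proof. by rewrite !exp2E mulrDl expRD. Qed.

Lemma exp2N x : exp2 (- x) = (exp2 x)^-1.
Proof. by rewrite !exp2E mulNr expRN. Qed.

Lemma exp2B x y : exp2 (x - y) = exp2 x / exp2 y.
Proof. by rewrite exp2D exp2N. Qed.

Lemma exp2_nat n : exp2 (n%:R : R) = 2 ^+ n.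
Proof. by rewrite /exp2 powR_mulrn. Qed.

Lemma ler_exp2 x y : (exp2 x <= exp2 y) = (x <= y).
Proof. by rewrite !exp2E ler_expR ler_pM2r // ln_gt0 // ltr1n. Qed.

Lemma exp2_log2 x : 0 < x -> exp2 (log2 x) = x.
Proof.
by move=> x0; rewrite exp2E /log2 divfK ?lnK // gt_eqF // ln_gt0 // ltr1n.
Qed.

Lemma log2_exp2 x : log2 (exp2 x) = x.
Proof. by rewrite /log2 exp2E expRK mulfK // gt_eqF // ln_gt0 // ltr1n. Qed.

Lemma exp2_ge x : x <= 2 * exp2 x.
Proof.
have l2 : 2^-1 <= ln 2 :> R.
  have := @expR_ge1Dx R (- ln 2); rewrite expRN lnK ?posrE //; lra.
have := expR_ge1Dx (x * ln 2); rewrite -exp2E.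
have := exp2_gt0 x; have [x0|x0] := lerP 0 x; nra.
Qed.

Lemma log2_le x y : 0 < x -> x <= y -> log2 x <= log2 y.
Proof.
by move=> x0 xy; rewrite -ler_exp2 !exp2_log2 // (lt_le_trans x0).
Qed.

(** The main term of the exponent, as a function of [x = log2 psi]. *)
Definition rate (n D : nat) x : R :=
  n%:R * 2 `^ ((n%:R - 1) / 2) * D%:R `^ ((n%:R - 1) / n%:R) * nroot n x.

(** The dimension minimizing [D d + rate m (2 D) (2 Lg / d)]. *)
Definition opt_dim (m D : nat) Lg : R :=
  2 `^ (m%:R / 2) * (Lg / D%:R) `^ (m.+1%:R^-1).

Lemma opt_dim_gt0 m D Lg : (0 < D)%N -> 0 < Lg -> 0 < opt_dim m D Lg.
Proof. by move=> D0 L0; rewrite mulr_gt0 ?powR_gt0 ?divr_gt0 ?ltr0n. Qed.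

Lemma ln_opt_dim m D Lg : (0 < D)%N -> 0 < Lg ->
  ln (opt_dim m D Lg) = m%:R / 2 * ln 2 + (ln Lg - ln D%:R) / m.+1%:R.
Proof.
move=> D0 L0; have DR : 0 < D%:R :> R by rewrite ltr0n.
rewrite /opt_dim lnM ?posrE ?powR_gt0 ?divr_gt0 // !ln_powR ln_div ?posrE //.
by rewrite [_^-1 * _]mulrC.
Qed.

(** In this lemma and the next both sides are monomials in 2, [D] and [Lg], so
    it is enough to compare logarithms. *)
Lemma rate_opt_dim m D Lg : (0 < D)%N -> 0 < Lg ->
  rate m.+1 D Lg = m.+1%:R * D%:R * opt_dim m D Lg.
Proof.
move=> D0 L0; have DR : 0 < D%:R :> R by rewrite ltr0n.
move: (opt_dim m D Lg) (opt_dim_gt0 m D0 L0) (ln_opt_dim m D0 L0) => u u0 lnu.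
rewrite /rate -!mulrA; congr (_ * _); apply: ln_inj; rewrite ?posrE.
- by rewrite !mulr_gt0 ?powR_gt0.
- by rewrite mulr_gt0.
rewrite !lnM ?posrE ?mulr_gt0 ?powR_gt0 // lnu !ln_powR.
have m0 : 1 + m%:R != 0 :> R by rewrite nat1r pnatr_eq0.
rewrite -!natr1; field.
by rewrite addrC.
Qed.

Lemma rate_pred_opt_dim m D Lg : (0 < m)%N -> (0 < D)%N -> 0 < Lg ->
  rate m D.*2 (2 * Lg / opt_dim m D Lg) = m%:R * D%:R * opt_dim m D Lg.
Proof.
move=> m0 D0 L0; have DR : 0 < D%:R :> R by rewrite ltr0n.
have mR : 0 < m%:R :> R by rewrite ltr0n.
move: (opt_dim m D Lg) (opt_dim_gt0 m D0 L0) (ln_opt_dim m D0 L0) => u u0 lnu.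
have D2 : D.*2%:R = 2 * D%:R :> R by rewrite -muln2 mulnC natrM.
rewrite /rate -!mulrA; congr (_ * _); apply: ln_inj; rewrite ?posrE.
- by rewrite !mulr_gt0 ?powR_gt0 ?D2 ?mulr_gt0 ?invr_gt0.
- by rewrite mulr_gt0.
rewrite D2 !lnM ?posrE ?mulr_gt0 ?powR_gt0 ?mulr_gt0 ?invr_gt0 // !ln_powR.
rewrite !lnM ?posrE ?mulr_gt0 ?invr_gt0 // lnV ?posrE // lnu.
have m1 : m%:R + 1 != 0 :> R by rewrite natr1 pnatr_eq0.
rewrite -!natr1; field.
by rewrite m1 gt_eqF.
Qed.

Lemma nroot_le n x y : 0 <= x -> x <= y -> nroot n x <= nroot n y.
Proof.
by move=> x0 xy; rewrite /nroot ge0_ler_powR ?nnegrE ?invr_ge0 // (le_trans x0).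
Qed.

Lemma superadd_exprn n x y : (0 < n)%N -> 0 <= x -> 0 <= y ->
  x ^+ n + y ^+ n <= (x + y) ^+ n.
Proof.
case: n => // n _ x0 y0; elim: n => [|n IHn]; first by rewrite !expr1.
rewrite exprS (exprS y) (exprS (x + y)).
apply: le_trans (ler_wpM2l (addr_ge0 x0 y0) IHn).
have := exprn_ge0 n.+1 x0; have := exprn_ge0 n.+1 y0; nra.
Qed.

Lemma nrootK n x : (0 < n)%N -> 0 <= x -> nroot n x ^+ n = x.
Proof.
move=> n0 x0; rewrite /nroot -powR_mulrn ?powR_ge0 // -powRrM mulVf ?powRr1 //.
by rewrite pnatr_eq0 -lt0n.
Qed.

Lemma nrootD n x y : (0 < n)%N -> 0 <= x -> 0 <= y ->
  nroot n (x + y) <= nroot n x + nroot n y.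
Proof.
move=> n0 x0 y0.
have r0 (z : R) : 0 <= nroot n z by exact: powR_ge0.
rewrite -(@ler_pXn2r _ n n0 (nroot n (x + y))) ?nnegrE ?addr_ge0 ?r0 // nrootK ?addr_ge0 //.
by apply: le_trans (superadd_exprn n0 (r0 x) (r0 y)); rewrite !nrootK.
Qed.

End Asymptotics.

Section Dimension.
Variable R : realType.
Implicit Types (x y z Lg : R).

Definition int_dim (m D : nat) Lg : nat := (Num.truncn (opt_dim m D Lg)).+1.

(** The binary logarithm of the number of shells, up to a bounded error. *)
Definition shell_log (m D : nat) Lg : R := 2 * Lg / (int_dim m D Lg)%:R.

Lemma rateD (m D : nat) x y : (0 < m)%N -> 0 <= x -> 0 <= y ->
  rate m D (x + y) <= rate m D x + rate m D y.
Proof.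
by move=> m0 x0 y0; rewrite /rate -mulrDr ler_wpM2l ?nrootD //.
Qed.

Lemma rate_le (m D : nat) x y : 0 <= x -> x <= y -> rate m D x <= rate m D y.
Proof.
by move=> x0 xy; rewrite /rate ler_wpM2l ?nroot_le // !mulr_ge0 ?powR_ge0.
Qed.

Lemma rate1 (D : nat) x : 0 <= x -> rate 1 D x = x.
Proof.
by move=> x0; rewrite /rate subrr !mul0r !powRr0 !mul1r /nroot invr1 powRr1.
Qed.

Lemma int_dim_bounds m D Lg : (0 < D)%N -> 1 <= Lg ->
  let u := opt_dim m D Lg in
  [/\ 0 < u, u <= (int_dim m D Lg)%:R, (int_dim m D Lg)%:R <= u + 1 &
      (int_dim m D Lg)%:R <= (1 + D%:R) * u].
Proof.
move=> D0 L1 u; have L0 : 0 < Lg by lra.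
have u0 : 0 < u := opt_dim_gt0 m D0 L0.
have DR : 1 <= D%:R :> R by rewrite ler1n.
have Du : 1 <= D%:R * u.
  have DR0 : 0 < D%:R :> R by lra.
  rewrite -ler_ln ?posrE //; last exact: mulr_gt0.
  rewrite ln1 lnM ?posrE // ln_opt_dim //.
  have l2 : 0 <= ln 2 :> R by rewrite ln_ge0 // ler1n.
  have lD : 0 <= ln D%:R :> R by rewrite ln_ge0.
  have lL : 0 <= ln Lg by rewrite ln_ge0.
  have q0 : 0 <= m.+1%:R^-1 :> R by [].
  have q1 : m.+1%:R^-1 <= 1 :> R by rewrite invf_le1 // ler1n.
  have ml : 0 <= m%:R / 2 * ln 2 :> R by rewrite !mulr_ge0.
  by move: (m.+1%:R^-1) q0 q1 => q q0 q1; nra.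
have /andP[tu ut] := truncn_itv (ltW u0).
rewrite /int_dim -/u; split=> //; [exact: ltW | by rewrite -natr1; lra |].
by rewrite -natr1; lra.
Qed.

(** Rounding the optimal real dimension [u] up costs only a bounded factor: the
    box term [d D] grows by at most [D], and the other term decreases in [d]. As
    [d <= (1 + D) u], the logarithm of [shell_log] is that of [2 Lg / u] up to a
    constant. The constant [c] makes room for a bounded error in the logarithm
    of the number of shells. *)
Lemma exponent_bound (m D : nat) (c : R) : (0 < m)%N -> (0 < D)%N -> 0 <= c ->
  exists K : R, forall Lg, 1 <= Lg ->
    - rate m.+1 D Lg + 1 / (2 * m.+1%:R) * log2 Lg
      <= K - (int_dim m D Lg)%:R * D%:R - rate m D.*2 (shell_log m D Lg + c)
         + 1 / (2 * m%:R) * log2 (shell_log m D Lg).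
Proof.
move=> m0 D0 c0.
pose c5 : R := (ln 2 - ln (1 + D%:R) - m%:R / 2 * ln 2 + ln D%:R / m.+1%:R) / ln 2.
exists (D%:R + rate m D.*2 c - c5 / (2 * m%:R)); move=> Lg L1.
rewrite /shell_log; set d := int_dim m D Lg; set U := 2 * Lg / d%:R.
have L0 : 0 < Lg by lra.
have [u0 ud du dDu] := int_dim_bounds m D0 L1.
have rE := rate_opt_dim m D0 L0; have rE' := rate_pred_opt_dim m0 D0 L0.
have lnu := ln_opt_dim m D0 L0.
move: (opt_dim m D Lg) u0 ud du dDu rE rE' lnu; rewrite -/d => u u0 ud du dDu rE rE' lnu.
have mR : 0 < m%:R :> R by rewrite ltr0n.
have DR : 0 < D%:R :> R by rewrite ltr0n.
have d0 : 0 < d%:R :> R by rewrite (lt_le_trans u0).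
have U0 : 0 <= U by rewrite divr_ge0 ?mulr_ge0 // ltW.
have Uu : U <= 2 * Lg / u by rewrite ler_wpM2l ?lef_pV2 ?posrE // mulr_ge0 // ltW.
have rU : rate m D.*2 (U + c) <= m%:R * D%:R * u + rate m D.*2 c.
  by apply: le_trans (rateD _ m0 U0 c0) _; rewrite lerD2r -rE' rate_le.
have l2 : 0 < ln 2 :> R by rewrite ln_gt0 // ltr1n.
have lU : m%:R / m.+1%:R * log2 Lg + c5 <= log2 U.
  apply: (@le_trans _ _ (log2 (2 * Lg / ((1 + D%:R) * u)))); last first.
    apply: log2_le; first by rewrite !(mulr_gt0, invr_gt0) ?addr_gt0.
    by rewrite ler_wpM2l ?lef_pV2 ?posrE ?mulr_gt0 ?addr_gt0 // mulr_ge0 // ltW.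
  rewrite /log2 ln_div ?posrE ?mulr_gt0 ?addr_gt0 // !lnM ?posrE ?addr_gt0 // lnu.
  have m1 : m%:R + 1 != 0 :> R by rewrite natr1 pnatr_eq0.
  rewrite le_eqVlt; apply/orP; left; apply/eqP; rewrite /c5 -[m.+1%:R]natr1; field.
  by rewrite m1 andbT gt_eqF.
have lU' : 1 / (2 * m.+1%:R) * log2 Lg + c5 / (2 * m%:R) <= 1 / (2 * m%:R) * log2 U.
  have m20 : 0 <= 1 / (2 * m%:R) :> R by rewrite divr_ge0 // mulr_ge0 // ltW.
  apply: le_trans (ler_wpM2l m20 lU); rewrite le_eqVlt; apply/orP; left; apply/eqP.
  have m1 : m%:R + 1 != 0 :> R by rewrite natr1 pnatr_eq0.
  by rewrite -[m.+1%:R]natr1; field; rewrite m1 gt_eqF.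
have dD : d%:R * D%:R <= u * D%:R + D%:R by rewrite -[X in _ + X]mul1r -mulrDl ler_pM2r.
have -> : rate m.+1 D Lg = m%:R * D%:R * u + u * D%:R.
  by rewrite rE -[m.+1%:R]natr1; ring.
move: (1 / (2 * m.+1%:R) * log2 Lg) (c5 / (2 * m%:R)) (1 / (2 * m%:R) * log2 U) lU'.
move: (rate m D.*2 (U + c)) (rate m D.*2 c) (m%:R * D%:R * u) rU (d%:R * D%:R) dD.
by move: (u * D%:R) => p r1 r2 q hq v hv a b e he; lra.
Qed.

End Dimension.

Section Induction.
Variables (R : realType) (k : nat).

(** Only the value of [Psi] at the cardinal of [S] matters, so a real [psi] takes
    its place; the induction needs this freedom to choose [psi]. *)
Definition has_density (n D : nat) : Prop :=
  exists2 C : R, 0 < C & forall (S : {fset int}) (psi : R),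
    S != fset0 -> 2 <= psi -> (TypekD R k D S)%:R <= (#|` S|)%:R * psi ->
    C * exp2 (- rate n D (log2 psi) + 1 / (2 * n%:R) * log2 (log2 psi))
      <= (rkD R k D S)%:R / (#|` S|)%:R.

(** Half the constant that [rkD_ge_shells] allows; the other half pays for the
    factor 2 in front of [Psi]. *)
Definition kappa0 (D : nat) : R := (24 * expR 1 * 2 ^+ D)^-1.

(** [eta] is the width of a shell in units of [M^2], when a ball of the
    corresponding radius has measure about [2^(- Lg)]. The right-hand side of
    the inequality is the proportion of the box that the shells with indices in
    [A] occupy, up to a constant. *)
Definition has_shells (m D : nat) : Prop :=
  exists c C : R, [/\ 0 <= c, 0 < C & forall Lg : R, 1 <= Lg ->
    let d := int_dim m D Lg in let U := shell_log m D Lg in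
    let eta := kappa0 D ^+ 2 * exp2 (- U) * d%:R in
    exists (L : nat) (A : {fset int}),
      [/\ forall z, z \in A -> 0 <= z < L%:Z, progression_free R k D.*2 A &
       C * exp2 (- rate m D.*2 (U + c) + 1 / (2 * m%:R) * log2 U)
         <= (#|` A|)%:R * eta / (Num.sqrt d%:R + L%:R * eta)]].

Lemma kappa0_gt0 D : 0 < kappa0 D.
Proof. by rewrite invr_gt0 !mulr_gt0 ?exprn_gt0 ?expR_gt0. Qed.

Lemma density_of_shells (m D : nat) : (0 < m)%N -> (0 < D)%N -> (D.*2 < k)%N ->
  has_shells m D -> has_density m.+1 D.
Proof.
move=> m0 D0 Dk [c [C [c0 C0 sh]]].
have [K hK] := exponent_bound m0 D0 c0.
have B0 : 0 < 128 * 4 ^+ D :> R by rewrite mulr_gt0 // exprn_gt0.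
exists (C * exp2 (- K) / (128 * 4 ^+ D)).
  by rewrite !mulr_gt0 ?invr_gt0 ?exp2_gt0.
move=> S psi S0 psi2 TS; set Lg := log2 psi.
have psi0 : 0 < psi by lra.
have psiE : exp2 Lg = psi by rewrite exp2_log2.
have L1 : 1 <= Lg by rewrite -ler_exp2 psiE -[1]/(1%:R) exp2_nat expr1.
have d0 : (0 < int_dim m D Lg)%N by [].
have {sh} := sh Lg L1; have {hK} := hK Lg L1; rewrite /shell_log.
move: (int_dim m D Lg) d0 => d d0; set U := 2 * Lg / d%:R.
set eta := _ * d%:R => hK [L [A [AL Af hA]]].
have dR : 0 < d%:R :> R by rewrite ltr0n.
pose kap := kappa0 D * exp2 (- (Lg / d%:R)).
have kap0 : 0 < kap by rewrite mulr_gt0 ?kappa0_gt0 ?exp2_gt0.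
have kap2 : kap ^+ 2 * d%:R = eta.
  rewrite /kap exprMn /eta; congr (_ * _ * _).
  by rewrite expr2 -exp2D; congr exp2; rewrite /U; field; rewrite gt_eqF.
have kapP : 2 * psi * (12 * expR 1 * 2 ^+ D * kap) ^+ d <= 1.
  have -> : 12 * expR 1 * 2 ^+ D * kap = exp2 (- (Lg / d%:R + 1)).
    have e1 : exp2 (- 1 : R) = 2^-1 by rewrite exp2N (exp2_nat R 1) expr1.
    rewrite /kap opprD exp2D e1 /kappa0; field.
    by rewrite expf_neq0 //= gt_eqF ?expR_gt0.
  have -> : exp2 (- (Lg / d%:R + 1)) ^+ d = exp2 (- Lg) * exp2 (- d%:R).
    rewrite -exp2D exp2E -expRM_natl exp2E; congr expR.
    by field; rewrite gt_eqF.
  rewrite exp2N psiE mulrA -(mulrA 2) divff ?gt_eqF // mulr1 exp2N exp2_nat.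
  by rewrite ler_pdivrMr ?exprn_gt0 // mul1r ler_eXnr // ler1n.
have := rkD_ge_shells D0 d0 Dk AL Af TS kap0 kapP; rewrite kap2.
have N0 : 0 < (#|` S|)%:R :> R by rewrite ltr0n cardfs_gt0.
have e0 : 0 < eta by rewrite /eta !mulr_gt0 ?exprn_gt0 ?kappa0_gt0 ?exp2_gt0.
set Y := _ + L%:R * eta; have Y0 : 0 < Y.
  by rewrite ltr_pwDl ?sqrtr_gt0 // mulr_ge0 // ltW.
move=> key; rewrite ler_pdivlMr //.
have dDE : exp2 (d%:R * D%:R) = 2 ^+ (d * D) :> R by rewrite -natrM exp2_nat.
have : exp2 (- rate m.+1 D Lg + 1 / (2 * m.+1%:R) * log2 Lg) <=
   exp2 K / 2 ^+ (d * D) * exp2 (- rate m D.*2 (U + c) + 1 / (2 * m%:R) * log2 U).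
  by rewrite -dDE -[X in _ <= X * _]exp2B -[X in _ <= X]exp2D ler_exp2 addrA.
move: (exp2 (- rate m.+1 D Lg + _)) (exp2 (- rate m D.*2 (U + c) + _)) hA => E F hA main.
have p2 : 0 < 2 ^+ (d * D) :> R by rewrite exprn_gt0.
have K1 : exp2 (- K) * exp2 K = 1 by rewrite exp2N mulVf // gt_eqF ?exp2_gt0.
have s1 : C * exp2 (- K) * E * 2 ^+ (d * D) <= C * F.
  apply: (@le_trans _ _ (C * exp2 (- K) * (exp2 K / 2 ^+ (d * D) * F) * 2 ^+ (d * D))).
    by rewrite (ler_wpM2r (ltW p2)) // ler_wpM2l // mulr_ge0 ?(ltW C0) ?(ltW (exp2_gt0 _)).
  rewrite le_eqVlt; apply/orP; left; apply/eqP.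
  transitivity (C * (exp2 (- K) * exp2 K) * F); last by rewrite K1 mulr1.
  by field; rewrite gt_eqF.
have s2 : C * F * Y <= (#|` A|)%:R * eta by rewrite -ler_pdivlMr.
have YB : 0 < 128 * 2 ^+ (d * D) * 4 ^+ D * Y by rewrite !mulr_gt0 ?exprn_gt0.
rewrite -(ler_pM2r YB); apply: le_trans key.
apply: (@le_trans _ _ ((#|` S|)%:R * (C * F * Y))); last by rewrite ler_pM2l.
apply: (@le_trans _ _ ((#|` S|)%:R * (C * exp2 (- K) * E * 2 ^+ (d * D) * Y))); last first.
  by rewrite ler_pM2l // ler_pM2r.
rewrite le_eqVlt; apply/orP; left; apply/eqP; field.
by rewrite expf_neq0.
Qed.


Lemma exp2_half_log2 (x : R) : 0 < x -> exp2 (2^-1 * log2 x) = Num.sqrt x.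
Proof.
move=> x0; rewrite -[x in RHS](exp2_log2 x0).
have -> : exp2 (log2 x) = exp2 (2^-1 * log2 x) ^+ 2.
  by rewrite expr2 -exp2D; congr exp2; lra.
by rewrite sqrtr_sqr ger0_norm // ltW // exp2_gt0.
Qed.

(** One shell occupies the proportion [eta / sqrt d], about
    [sqrt d 2^(- U)] with [U = shell_log 1 D Lg], and [d] and [U] are of the same
    order. *)
Lemma one_shell (D : nat) : (0 < D)%N -> (0 < k)%N -> has_shells 1 D.
Proof.
move=> D0 k0; have DR : 1 <= D%:R :> R by rewrite ler1n.
pose c2 : R := kappa0 D ^+ 2; have c20 : 0 < c2 by rewrite exprn_gt0 ?kappa0_gt0.
pose c6 : R := 2 * (1 + D%:R) ^+ 2.
have c60 : 0 < c6 by rewrite mulr_gt0 // exprn_gt0 // addr_gt0 //; lra.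
have h0 : 0 < 1 + c2 * c6 by rewrite addr_gt0 // mulr_gt0.
have sD0 : 0 < Num.sqrt (D%:R : R) by rewrite sqrtr_gt0; lra.
exists 0, (c2 / (Num.sqrt D%:R * (1 + c2 * c6))); split=> //.
  by rewrite divr_gt0 // mulr_gt0.
move=> Lg L1; have L0 : 0 < Lg by lra.
have [u0 ud _ dDu] := int_dim_bounds 1 D0 L1.
have rE := rate_pred_opt_dim (ltn0Sn 0) D0 L0.
have uu0 : 0 <= 2 * Lg / opt_dim 1 D Lg by apply: divr_ge0; [lra | exact: ltW].
rewrite rate1 // mul1r in rE.
have dn0 : (0 < int_dim 1 D Lg)%N by [].
cbv zeta; rewrite /shell_log.
move: (opt_dim 1 D Lg) (int_dim 1 D Lg) dn0 u0 ud dDu rE {uu0} => u d dn0 u0 ud dDu rE.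
set U := 2 * Lg / d%:R; rewrite -/c2; set eta := c2 * exp2 (- U) * d%:R.
have d0 : 0 < d%:R :> R by exact: lt_le_trans ud.
have d1 : 1 <= d%:R :> R by rewrite ler1n.
have U0 : 0 < U by rewrite divr_gt0 // mulr_gt0.
have dU : d%:R * U = D%:R * u ^+ 2.
  by rewrite expr2 mulrA -rE /U; field; rewrite !gt_eqF.
have UDd : U <= D%:R * d%:R.
  by rewrite -(ler_pM2l d0) dU [X in _ <= X]mulrCA ler_wpM2l // -expr2 lerXn2r ?nnegrE ?(ltW u0) ?(ltW d0).
have dc6 : Num.sqrt d%:R <= c6 * exp2 U.
  have dU6 : d%:R <= (1 + D%:R) ^+ 2 * U.
    rewrite -(ler_pM2l d0) (_ : _ * (_ * U) = (1 + D%:R) ^+ 2 * (d%:R * U)); last by ring.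
    rewrite dU; apply: (@le_trans _ _ (((1 + D%:R) * u) * ((1 + D%:R) * u))).
      by rewrite ler_pM // ltW.
    have : 0 <= (1 + D%:R) ^+ 2 * u ^+ 2 by rewrite mulr_ge0 ?sqr_ge0.
    nra.
  apply: (@le_trans _ _ d%:R).
    have s1 : 1 <= Num.sqrt (d%:R : R) by rewrite -[X in X <= _]sqrtr1 ler_wsqrtr.
    by rewrite -[X in _ <= X]sqr_sqrtr ?(ltW d0) // expr2 ler_peMl //; lra.
  apply: (le_trans dU6); rewrite (_ : c6 * _ = (1 + D%:R) ^+ 2 * (2 * exp2 U)); last by rewrite /c6; ring.
  by rewrite ler_wpM2l ?sqr_ge0 ?exp2_ge.
exists 1%N, [fset 0]%fset; split.
- by move=> z; rewrite inE => /eqP ->.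
- move=> [a [[[i [j aij]] _] aA]]; apply: aij.
  by have := aA i; have := aA j; rewrite !inE => /eqP -> /eqP ->.
rewrite cardfs1 !mul1r addr0 rate1 ?(ltW U0) // mulr1 exp2D exp2_half_log2 //.
have e0 : 0 < exp2 (- U) := exp2_gt0 _.
have eta0 : 0 < eta := mulr_gt0 (mulr_gt0 c20 e0) d0.
have s0 : 0 < Num.sqrt (d%:R : R) by rewrite sqrtr_gt0.
have ss : Num.sqrt (d%:R : R) ^+ 2 = d%:R by rewrite sqr_sqrtr ?(ltW d0).
rewrite ler_pdivlMr ?addr_gt0 //.
have sU : Num.sqrt U <= Num.sqrt D%:R * Num.sqrt d%:R.
  by rewrite -sqrtrM ?ler_wsqrtr //; lra.
have etaE : eta = c2 * (exp2 (- U) * Num.sqrt d%:R) * Num.sqrt d%:R.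
  by rewrite /eta -[in LHS]ss; ring.
have etas : eta <= c2 * c6 * Num.sqrt d%:R.
  rewrite etaE (ler_wpM2r (ltW s0)) // (ler_wpM2l (ltW c20)) //.
  by rewrite exp2N mulrC ler_pdivrMr ?exp2_gt0.
apply: (@le_trans _ _ (c2 / (Num.sqrt D%:R * (1 + c2 * c6)) *
   (exp2 (- U) * (Num.sqrt D%:R * Num.sqrt d%:R)) * (Num.sqrt d%:R * (1 + c2 * c6)))).
  rewrite ler_pM //.
  - by rewrite !mulr_ge0 ?invr_ge0 ?sqrtr_ge0 ?mulr_ge0 ?sqrtr_ge0 ?(ltW c20) ?(ltW e0) ?(ltW h0).
  - by rewrite addr_ge0 ?sqrtr_ge0 // ltW.
  - rewrite ler_wpM2l ?ler_wpM2l ?(ltW e0) //.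
    by rewrite divr_ge0 ?(ltW c20) // mulr_ge0 ?sqrtr_ge0 // ltW.
  - by rewrite mulrDr mulr1 lerD2l mulrC.
rewrite le_eqVlt; apply/orP; left; apply/eqP; rewrite etaE; field.
by rewrite !gt_eqF.
Qed.

(** The squared length of a curve of degree at most [D] has degree at most
    [2 D], so the indices must avoid progressions of degree up to [2 D] in an
    initial segment: this is the theorem again. With [L] about [2^U / c2] the
    shells fill the interval of concentration, and the [O(L^2)] types give
    [psi = T 2^U]. *)
Lemma shells_of_density (m D : nat) : (0 < m)%N -> (0 < D)%N -> (D.*2 < k)%N ->
  has_density m D.*2 -> has_shells m D.
Proof.
move=> m0 D0 Dk [C C0 dens].
pose c2 : R := kappa0 D ^+ 2; have c20 : 0 < c2 by rewrite exprn_gt0 ?kappa0_gt0.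
have [T TE] : exists T : R, T = (D.*2.+1 * 2 ^ D.*2.+2)%:R * (1 + c2^-1) by eexists.
have T2 : 2 <= T.
  rewrite TE -[2]mulr1 ler_pM //; last by rewrite lerDl invr_ge0 ltW.
  by rewrite (ler_nat R 2) !expnS; have := expn_gt0 2 D.*2; nia.
have T0 : 0 < T by lra.
exists (log2 T), (C / 2); split.
- by rewrite -ler_exp2 exp2_log2 // (exp2_nat R 0) expr0; lra.
- by rewrite divr_gt0.
move=> Lg L1; have L0 : 0 < Lg by lra.
have dn0 : (0 < int_dim m D Lg)%N by [].
cbv zeta; rewrite /shell_log; move: (int_dim m D Lg) dn0 => d dn0.
set U := 2 * Lg / d%:R; rewrite -/c2; set eta := c2 * exp2 (- U) * d%:R.
have d1 : 1 <= d%:R :> R by rewrite ler1n.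
have d0 : 0 < d%:R :> R by lra.
have U0 : 0 < U by rewrite divr_gt0 // mulr_gt0.
have eU0 := exp2_gt0 U.
have eU1 : 1 <= exp2 U by rewrite -(expr0 2) -(exp2_nat R 0) ler_exp2 ltW.
have [L [L_gt L_le]] : exists L : nat,
    exp2 U / c2 <= L%:R /\ L%:R <= (1 + c2^-1) * exp2 U.
  have x0 : 0 <= exp2 U / c2 by rewrite divr_ge0 // ltW.
  have /andP[xL Lx] := truncn_itv x0; exists (Num.truncn (exp2 U / c2)).+1.
  by split; [exact: ltW | rewrite -natr1 mulrDl mul1r [c2^-1 * _]mulrC; lra].
have LR : 0 < L%:R :> R by rewrite (lt_le_trans _ L_gt) // divr_gt0.
have L0' : (0 < L)%N by rewrite -(ltr0n R).
set I := initial_segment L.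
have I0 : I != fset0 by rewrite -cardfs_gt0 card_initial_segment.
have psiE : T * exp2 U = exp2 (U + log2 T) by rewrite exp2D exp2_log2 // mulrC.
have psi2 : 2 <= T * exp2 U by rewrite -[2]mulr1 ler_pM.
have TI : (TypekD R k D.*2 I)%:R <= (#|` I|)%:R * (T * exp2 U).
  rewrite card_initial_segment.
  apply: (@le_trans _ _ (L * (D.*2.+1 * 2 ^ D.*2.+2 * L))%:R).
    by rewrite ler_nat types_initial_segment.
  by rewrite natrM ler_wpM2l // natrM TE -mulrA ler_wpM2l.
have := dens I _ I0 psi2 TI; rewrite psiE.
rewrite log2_exp2.
have [A [AI Af <-]] := rkD_attained R D.*2 I (leq_ltn_trans (leq0n _) Dk).
rewrite card_initial_segment => dI.
exists L, A; split=> //.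
  by move=> z /(fsubsetP AI); rewrite mem_initial_segment.
have T1 : 0 <= log2 T by rewrite -ler_exp2 exp2_log2 // (exp2_nat R 0) expr0; lra.
have lU : log2 U <= log2 (U + log2 T) by apply: log2_le => //; lra.
have m2 : 0 <= 1 / (2 * m%:R) :> R by rewrite divr_ge0 ?mulr_ge0.
have eta0 : 0 < eta := mulr_gt0 (mulr_gt0 c20 (exp2_gt0 _)) d0.
apply: (@le_trans _ _ ((#|` A|)%:R / L%:R / 2)); last first.
  have Le : Num.sqrt d%:R <= L%:R * eta.
    apply: (@le_trans _ _ d%:R).
      have s1 : 1 <= Num.sqrt (d%:R : R) by rewrite -[X in X <= _]sqrtr1 ler_wsqrtr.
      by rewrite -[X in _ <= X]sqr_sqrtr ?(ltW d0) // expr2 ler_peMl //; lra.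
    rewrite (_ : L%:R * eta = L%:R * (c2 / exp2 U) * d%:R); last by rewrite /eta exp2N; ring.
    rewrite (ler_peMl (ltW d0)) //.
    by move: L_gt; rewrite ler_pdivrMr // mulrA ler_pdivlMr // mul1r.
  have Y0 : 0 < Num.sqrt (d%:R : R) + L%:R * eta.
    by rewrite (addr_gt0 _ (mulr_gt0 LR eta0)) // sqrtr_gt0.
  rewrite ler_pdivlMr //.
  apply: (@le_trans _ _ ((#|` A|)%:R / L%:R / 2 * (L%:R * eta + L%:R * eta))).
    by rewrite ler_wpM2l ?lerD2r // !divr_ge0.
  rewrite le_eqVlt; apply/orP; left; apply/eqP; field.
  by rewrite gt_eqF.
rewrite mulrAC ler_wpM2r //; apply: le_trans dI.
rewrite ler_wpM2l ?(ltW C0) // ler_exp2 lerD2l ler_wpM2l //.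
Qed.

Lemma density_bound (n D : nat) : (2 <= n)%N -> (0 < D)%N -> (2 ^ n.-1 * D < k)%N ->
  has_density n D.
Proof.
case: n => [//|[//|m]] _; elim: m D => [|m IHm] D D0 Dk.
  have Dk2 : (D.*2 < k)%N by move: Dk; rewrite expn1 mul2n.
  by apply: density_of_shells => //; apply: one_shell => //; lia.
have Dk' : (2 ^ m.+1 * D.*2 < k)%N.
  by move: Dk; rewrite /= (expnS 2 m.+1) -mul2n mulnCA mulnA.
have Dk2 : (D.*2 < k)%N by apply: leq_ltn_trans Dk'; rewrite leq_pmull ?expn_gt0.
apply: density_of_shells => //; apply: shells_of_density => //.
by apply: IHm; rewrite ?double_gt0.
Qed.

End Induction.

Theorem theorem1 (R : realType) (k D : nat) (Psi : nat -> R) :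
  (3 <= k)%N -> (1 <= D)%N ->
  (forall N : nat, (0 < N)%N -> 2 <= Psi N) ->
  exists C : R, 0 < C /\
    forall n : nat, (2 <= n)%N -> (2 ^ n.-1 * D < k)%N ->
    forall S : {fset int}, S != fset0 ->
    let N := #|` S|%fset in
    (TypekD R k D S)%:R <= N%:R * Psi N ->
    (rkD R k D S)%:R / N%:R >=
      C * exp2 (- (n%:R * 2 `^ ((n%:R - 1) / 2) * D%:R `^ ((n%:R - 1) / n%:R)
                   * nroot n (log2 (Psi N)))
                + 1 / (2 * n%:R) * log2 (log2 (Psi N))).
Proof.
move=> _ D0 Psi2.
(* only the finitely many [n < k] are possible, so one constant serves them all *)
suff /(_ k) [C [C0 hC]] : forall K : nat, exists C : R, 0 < C /\
    forall n : nat, (n < K)%N -> (2 <= n)%N -> (2 ^ n.-1 * D < k)%N ->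
    forall (S : {fset int}) (psi : R),
      S != fset0 -> 2 <= psi -> (TypekD R k D S)%:R <= (#|` S|)%:R * psi ->
      C * exp2 (- rate n D (log2 psi) + 1 / (2 * n%:R) * log2 (log2 psi))
        <= (rkD R k D S)%:R / (#|` S|)%:R.
  exists C; split=> // n n2 nk S S0 N TS.
  apply: hC => //; last by apply: Psi2; rewrite cardfs_gt0.
  apply: leq_ltn_trans nk; rewrite -[n in (n <= _)%N]prednK; last exact: ltnW.
  by apply: leq_trans (ltn_expl _ (ltnSn 1)) _; rewrite leq_pmulr.
elim=> [|K [C [C0 hC]]]; first by exists 1.
have [[K2 Kk]|nK] := pselect ((2 <= K)%N /\ (2 ^ K.-1 * D < k)%N); last first.
  exists C; split=> // n nK' n2 nk; apply: hC => //.
  rewrite ltn_neqAle -ltnS nK' andbT; apply/eqP => nE.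
  by apply: nK; rewrite -nE.
have [C' C'0 hC'] := density_bound R K2 D0 Kk.
exists (Num.min C C'); split=> [|n nK n2 nk S psi S0 psi2 TS]; first by rewrite lt_min C0.
have [nE|/eqP nE] := eqVneq n K.
  rewrite nE; apply: le_trans (hC' S psi S0 psi2 TS).
  by rewrite (ler_wpM2r (ltW (exp2_gt0 _))) // ge_min lexx orbT.
apply: le_trans (hC n _ n2 nk S psi S0 psi2 TS); last by lia.
by rewrite (ler_wpM2r (ltW (exp2_gt0 _))) // ge_min lexx.
Qed.
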